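(* Let $\xi=(p:E\to B)$ be a fibration endowed with a cleavage $\Sigma$. If the cleavage $\Sigma$ is closed, then the map $\bar k i:\nabla N_cE\to NE$ is an isomorphism of simplicial sets.
   Context: All categories are small. For a functor $p:E\to B$, an arrow $f:e\to e'$ of $E$ is cartesian if for every $g:e\to e''$ with $p(g)=p(f)$ there is a unique $h:e'\to e''$ with $p(h)=\mathrm{id}_{p(e')}$ and $hf=g$. The functor $p$ is a prefibration if for every object $e$ of $E$ and every arrow $\phi:p(e)\to b$ of $B$ there is a cartesian arrow with domain $e$ lying over $\phi$; it is a fibration if moreover cartesian arrows are closed under composition. A cleavage of $p$ is a set $\Sigma$ of cartesian arrows of $E$ such that for every object $e$ of $E$ and every $\phi:p(e)\to b$ there is a unique arrow in $\Sigma$ with domain $e$ over $\phi$. All cleavages are assumed normal, i.e. containing the identities. A cleavage is closed if it is closed under composition. A fibred map $(f,g):\xi\to\xi'$ between fibrations $p:E\to B$, $p':E'\to B'$ is a pair of functors $f:E\to E'$, $g:B\to B'$ with $p'f=gp$ and $f$ preserving cartesian arrows; the set of these is $\mathrm{Fib}(\xi,\xi')$. If cleavages $\Sigma,\Sigma'$ are given, it is a cleaved map if moreover $f(\Sigma)\subset\Sigma'$; the set of these is $\mathrm{Cliv}((\xi,\Sigma),(\xi',\Sigma'))$. Let $\underline n=\{0<\dots<n\}$, viewed as a category, and let $\square_{m,n}$ be the fibration $\mathrm{pr}_2:\underline m\times\underline n\to\underline n$ with its unique cleavage $\{(\mathrm{id},\alpha)\}$; it is functorial in $(m,n)\in\Delta\times\Delta$.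 The fibred nerve $N_fE$ is the bisimplicial set $(N_fE)_{m,n}=\mathrm{Fib}(\square_{m,n},\xi)$ and the cleaved nerve $N_cE$ is $(N_cE)_{m,n}=\mathrm{Cliv}(\square_{m,n},(\xi,\Sigma))$, with structure maps given by precomposition; $i:N_cE\to N_fE$ is the inclusion. In a bisimplicial set $K=\{K_{m,n}\}$ the vertical operators $d^v,s^v$ act on the index $m$ and the horizontal operators $d^h,s^h$ on the index $n$. The codiagonal of a bisimplicial set $K$ is the simplicial set $\nabla(K)$ with $$\nabla(K)_n=\{(x_0,\dots,x_n): x_i\in K_{i,n-i},\ d_0^hx_i=d_{i+1}^vx_{i+1}\text{ for }0\le i<n\},$$ $$d_i(x_0,\dots,x_n)=(d_i^hx_0,d_{i-1}^hx_1,\dots,d_1^hx_{i-1},d_i^vx_{i+1},\dots,d_i^vx_n),$$ $$s_j(x_0,\dots,x_n)=(s_j^hx_0,s_{j-1}^hx_1,\dots,s_0^hx_j,s_j^vx_j,\dots,s_j^vx_n).$$ Also $i$ denotes the induced map $\nabla N_cE\to\nabla N_fE$. Let $T_n$ be the full subcategory of $\underline n\times\underline n$ on the pairs $(a,b)$ with $a\le b$, regarded as a fibration via $\mathrm{pr}_2:T_n\to\underline n$; it is functorial in $\underline n\in\Delta$. There is a canonical isomorphism $\mathrm{Fib}(T_n,\xi)\cong(\nabla N_fE)_n$, $x\mapsto(x\alpha^0,\dots,x\alpha^n)$, where $\alpha^r:\square_{r,n-r}\to T_n$ is the fibred map given on total categories by $(a,b)\mapsto(a,b+r)$. Under this identification,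 $\bar k:\nabla N_fE\to NE$ sends $x=(x_0,x_1)\in\mathrm{Fib}(T_n,\xi)$ (with $x_0:T_n\to E$, $x_1:\underline n\to B$) to the $n$-simplex $x_0\circ\mathrm{diag}:\underline n\to E$, where $\mathrm{diag}(a)=(a,a)$. $NE$ is the usual nerve of $E$. *)

(* Defs.v *)
From mathcomp Require Import all_boot.
From mathcomp Require Import boolp.
From mathcomp Require Import zify.

Set Implicit Arguments.
Unset Strict Implicit.
Unset Printing Implicit Defensive.

(* A small category is given by a type of objects and a type of all arrows, so
   that the strict equalities between arrows and between functors used below
   are plain equalities. [cmp g f e] is the composite [g f]. *)
Record category := Category {
  obj : Type;
  arr : Type;
  dom : arr -> obj;
  cod : arr -> obj;
  idt : obj -> arr;
  cmp : forall g f : arr, cod f = dom g -> arr;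
  dom_idt : forall x, dom (idt x) = x;
  cod_idt : forall x, cod (idt x) = x;
  dom_cmp : forall g f (e : cod f = dom g), dom (cmp e) = dom f;
  cod_cmp : forall g f (e : cod f = dom g), cod (cmp e) = cod g;
  cmp_idl : forall x f (e : cod f = dom (idt x)), cmp e = f;
  cmp_idr : forall x g (e : cod (idt x) = dom g), cmp e = g;
  cmpA : forall h g f (e1 : cod f = dom g) (e2 : cod (cmp e1) = dom h)
           (e3 : cod g = dom h) (e4 : cod f = dom (cmp e3)),
         cmp e2 = cmp e4
}.
Arguments idt {c} x.
Arguments cmp {c} g f e.

Lemma sub_eq (T : Type) (P : T -> Prop) (x y : {z | P z}) :
  sval x = sval y -> x = y.
Proof.
by case: x y => [x px] [y py] /= e; subst; congr exist; apply: Prop_irrelevance.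
Qed.

Lemma cmp_eq (C : category) (g g' f f' : arr C) e e' :
  g = g' -> f = f' -> cmp g f e = cmp g' f' e'.
Proof. by move=> eg ef; subst; congr cmp; apply: Prop_irrelevance. Qed.

Record functor (C D : category) := Functor {
  fobj : obj C -> obj D;
  farr : arr C -> arr D;
  farr_dom : forall f, dom (farr f) = fobj (dom f);
  farr_cod : forall f, cod (farr f) = fobj (cod f);
  farr_idt : forall x, farr (idt x) = idt (fobj x);
  farr_cmp : forall g f (e : cod f = dom g) (e' : cod (farr f) = dom (farr g)),
    farr (cmp g f e) = cmp (farr g) (farr f) e'
}.

Lemma functor_eq (C D : category) (F G : functor C D) :
  (forall f, farr F f = farr G f) -> F = G.
Proof.
move=> H.
have Ho : fobj F = fobj G.
  apply: funext => x.
  by rewrite -[LHS](@dom_idt D) -farr_idt H farr_idt dom_idt.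
have {H} Ha : farr F = farr G by apply: funext.
case: F G Ho Ha => [o a p1 p2 p3 p4] [o' a' q1 q2 q3 q4] /= Ho Ha.
by subst; congr Functor; apply: Prop_irrelevance.
Qed.

Lemma fcomp_dom C D E (G : functor D E) (F : functor C D) f :
  dom (farr G (farr F f)) = fobj G (fobj F (dom f)).
Proof. by rewrite !farr_dom. Qed.
Lemma fcomp_cod C D E (G : functor D E) (F : functor C D) f :
  cod (farr G (farr F f)) = fobj G (fobj F (cod f)).
Proof. by rewrite !farr_cod. Qed.
Lemma fcomp_idt C D E (G : functor D E) (F : functor C D) x :
  farr G (farr F (idt x)) = idt (fobj G (fobj F x)).
Proof. by rewrite !farr_idt. Qed.
Lemma farr_composable (C D : category) (F : functor C D) (g f : arr C) :
  cod f = dom g -> cod (farr F f) = dom (farr F g).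
Proof. by rewrite farr_dom farr_cod => ->. Qed.
Lemma fcomp_cmp C D E (G : functor D E) (F : functor C D) g f e e' :
  farr G (farr F (cmp g f e)) = cmp (farr G (farr F g)) (farr G (farr F f)) e'.
Proof. by rewrite (farr_cmp e (farr_composable F e)) (farr_cmp _ e'). Qed.

Definition fcomp (C D E : category) (G : functor D E) (F : functor C D) :
    functor C E :=
  Functor (fcomp_dom G F) (fcomp_cod G F) (fcomp_idt G F) (@fcomp_cmp _ _ _ G F).

Definition fid (C : category) : functor C C.
Proof.
refine (@Functor C C id id (fun=> erefl) (fun=> erefl) (fun=> erefl) _).
abstract (by move=> g f e e'; apply: cmp_eq).
Defined.

Definition prodcat (C D : category) : category.
Proof.
refine (@Category (obj C * obj D) (arr C * arr D)
  (fun f => (dom f.1, dom f.2)) (fun f => (cod f.1, cod f.2))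
  (fun x => (idt x.1, idt x.2))
  (fun g f e => (cmp g.1 f.1 (congr1 fst e), cmp g.2 f.2 (congr1 snd e)))
  _ _ _ _ _ _ _).
- abstract (by case=> x y; rewrite !dom_idt).
- abstract (by case=> x y; rewrite !cod_idt).
- abstract (by move=> [g g'] [f f'] e /=; rewrite !dom_cmp).
- abstract (by move=> [g g'] [f f'] e /=; rewrite !cod_cmp).
- abstract (by move=> [x y] [f f'] e; rewrite !cmp_idl).
- abstract (by move=> [x y] [f f'] e; rewrite !cmp_idr).
- abstract (by move=> h g f e1 e2 e3 e4; congr pair; apply: cmpA).
Defined.

Definition pr1 (C D : category) : functor (prodcat C D) C.
Proof.
refine (@Functor (prodcat C D) C fst fst
  (fun=> erefl) (fun=> erefl) (fun=> erefl) _).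
abstract (by move=> g f e e'; apply: cmp_eq).
Defined.

Definition pr2 (C D : category) : functor (prodcat C D) D.
Proof.
refine (@Functor (prodcat C D) D snd snd
  (fun=> erefl) (fun=> erefl) (fun=> erefl) _).
abstract (by move=> g f e e'; apply: cmp_eq).
Defined.

Definition fpair (A C D : category) (F : functor A C) (G : functor A D) :
  functor A (prodcat C D).
Proof.
refine (@Functor A (prodcat C D) (fun x => (fobj F x, fobj G x))
  (fun f => (farr F f, farr G f)) _ _ _ _).
- abstract (by move=> f; rewrite /= !farr_dom).
- abstract (by move=> f; rewrite /= !farr_cod).
- abstract (by move=> f; rewrite /= !farr_idt).
- abstract (by move=> g f e e'; congr pair; apply: farr_cmp).
Defined.

Definition fprod (A B C D : category) (F : functor A C) (G : functor B D) :
    functor (prodcat A B) (prodcat C D) :=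
  fpair (fcomp F (pr1 A B)) (fcomp G (pr2 A B)).

Definition fullsub (C : category) (P : pred (obj C)) : category.
Proof.
refine (@Category {x : obj C | P x} {f : arr C | P (dom f) && P (cod f)}
  (fun f => exist _ (dom (sval f)) (proj1 (andP (svalP f))))
  (fun f => exist _ (cod (sval f)) (proj2 (andP (svalP f))))
  (fun x => exist _ (idt (sval x)) _)
  (fun g f e => exist _ (cmp (sval g) (sval f) (congr1 sval e)) _)
  _ _ _ _ _ _ _).
Unshelve.
8: abstract (by rewrite dom_idt cod_idt (svalP x)).
8: abstract (by rewrite dom_cmp cod_cmp; case/andP: (svalP f) => -> _;
      case/andP: (svalP g) => _ ->).
- abstract (by intros; apply: sub_eq => /=; exact: dom_idt).
- abstract (by intros; apply: sub_eq => /=; exact: cod_idt).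
- abstract (by intros; apply: sub_eq => /=; exact: dom_cmp).
- abstract (by intros; apply: sub_eq => /=; exact: cod_cmp).
- abstract (by intros; apply: sub_eq => /=; exact: cmp_idl).
- abstract (by intros; apply: sub_eq => /=; exact: cmp_idr).
- abstract (by intros; apply: sub_eq => /=; exact: cmpA).
Defined.

Definition incl (C : category) (P : pred (obj C)) : functor (fullsub P) C.
Proof.
refine (@Functor (fullsub P) C sval sval
  (fun=> erefl) (fun=> erefl) (fun=> erefl) _).
abstract (by move=> g f e e'; apply: cmp_eq).
Defined.

Definition corestrict (A C : category) (P : pred (obj C)) (F : functor A C)
  (FP : forall x, P (fobj F x)) : functor A (fullsub P).
Proof.
refine (@Functor A (fullsub P)
  (fun x => exist _ (fobj F x) (FP x))
  (fun f => exist _ (farr F f) _) _ _ _ _).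
Unshelve.
5: abstract (by rewrite farr_dom farr_cod !FP).
- abstract (by intros; apply: sub_eq => /=; exact: farr_dom).
- abstract (by intros; apply: sub_eq => /=; exact: farr_cod).
- abstract (by intros; apply: sub_eq => /=; exact: farr_idt).
- abstract (by intros; apply: sub_eq => /=; exact: farr_cmp).
Defined.

Definition ordcat (n : nat) : category.
Proof.
refine (@Category 'I_n.+1 {f : 'I_n.+1 * 'I_n.+1 | f.1 <= f.2}
  (fun f => (sval f).1) (fun f => (sval f).2)
  (fun x => exist _ (x, x) (leqnn x))
  (fun g f e => exist _ ((sval f).1, (sval g).2)
     (leq_trans (svalP f) (eq_ind_r (fun x : 'I_n.+1 => x <= (sval g).2)
                             (svalP g) e)))
  _ _ _ _ _ _ _) ; try by [].
- abstract (by move=> x [[a b] f] e; apply: sub_eq; rewrite /= in e *; subst).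
- abstract (by move=> x [[a b] f] e; apply: sub_eq; rewrite /= in e *; subst).
- abstract (by intros; apply: sub_eq).
Defined.

(* The arrows m -> n of the simplex category: weakly monotone maps. *)
Record mono (m n : nat) := Mono {
  mfun :> 'I_m.+1 -> 'I_n.+1;
  mfunP : forall x y : 'I_m.+1, x <= y -> mfun x <= mfun y
}.

Lemma mono_eq m n (u v : mono m n) : (forall x, u x = v x :> nat) -> u = v.
Proof.
case: u v => [u pu] [v pv] /= H.
have e : u = v by apply: funext => x; apply: val_inj; apply: H.
by subst; congr Mono; apply: Prop_irrelevance.
Qed.

Definition mid n : mono n n := @Mono n n id (fun _ _ h => h).

Definition mcomp l m n (u : mono m n) (v : mono l m) : mono l n :=
  @Mono l n (fun x => u (v x)) (fun x y h => mfunP u (mfunP v h)).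

Lemma mcompE l m n (u : mono m n) (v : mono l m) x : mcomp u v x = u (v x).
Proof. by []. Qed.

Definition ordF m n (u : mono m n) : functor (ordcat m) (ordcat n).
Proof.
refine (@Functor (ordcat m) (ordcat n) u
  (fun f => exist _ (u (sval f).1, u (sval f).2) (mfunP u (svalP f))) 
  (fun=> erefl) (fun=> erefl) _ _).
all: abstract (by intros; apply: sub_eq).
Defined.

(* The injection [n] -> [n+1] that misses i. *)
Definition coface n (i : 'I_n.+2) : mono n n.+1.
Proof.
exists (lift i).
abstract (by move=> x y h; rewrite /= leq_bump2).
Defined.

(* The surjection [n+1] -> [n] that takes the value j twice. *)
Definition codegen_fun n (j : 'I_n.+1) (x : 'I_n.+2) : 'I_n.+1 :=
  inord (if x <= j then x : nat else x.-1).

Lemma codegen_funE n (j : 'I_n.+1) (x : 'I_n.+2) :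
  codegen_fun j x = (if x <= j then x : nat else x.-1) :> nat.
Proof.
rewrite /codegen_fun inordK //.
have := ltn_ord j; have := ltn_ord x; case: ifP; lia.
Qed.

Definition codegen n (j : 'I_n.+1) : mono n.+1 n.
Proof.
exists (codegen_fun j).
abstract (by move=> x y h; rewrite !codegen_funE; do 2![case: ifP]; lia).
Defined.

Lemma coface_val n i x : i < n.+2 ->
  @coface n (inord i) x = (if i <= x then x.+1 else x) :> nat.
Proof. by move=> h; rewrite /= inordK // /bump; case: (i <= x). Qed.

Lemma codegen_val n j x : j < n.+1 ->
  @codegen n (inord j) x = (if x <= j then x : nat else x.-1) :> nat.
Proof. by move=> h; rewrite /= codegen_funE inordK. Qed.

Record simplicial (X : nat -> Type) := Simplicial {
  face : forall n, 'I_n.+2 -> X n.+1 -> X n;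
  degen : forall n, 'I_n.+1 -> X n -> X n.+1;
  face_face : forall n (i j : nat) (x : X n.+2), i < j <= n.+2 ->
    face (inord i) (face (inord j) x) = face (inord j.-1) (face (inord i) x);
  degen_degen : forall n (i j : nat) (x : X n), i <= j <= n ->
    degen (inord i) (degen (inord j) x) =
    degen (inord j.+1) (degen (inord i) x);
  face_degen_lt : forall n (i j : nat) (x : X n.+1), i < j <= n.+1 ->
    face (inord i) (degen (inord j) x) = degen (inord j.-1) (face (inord i) x);
  face_degen_id : forall n (j : nat) (x : X n), j <= n ->
    face (inord j) (degen (inord j) x) = x;
  face_degen_idS : forall n (j : nat) (x : X n), j <= n ->
    face (inord j.+1) (degen (inord j) x) = x;
  face_degen_gt : forall n (i j : nat) (x : X n.+1), j.+1 < i <= n.+2 ->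
    face (inord i) (degen (inord j) x) = degen (inord j) (face (inord i.-1) x)
}.

Record sset := SSet {
  cell :> nat -> Type;
  sset_ops :> simplicial cell
}.

(* In [bicell m n] the vertical operators act on m, the horizontal ones on n. *)
Record bisset := BiSSet {
  bicell :> nat -> nat -> Type;
  vert : forall n, simplicial (fun m => bicell m n);
  horiz : forall m, simplicial (bicell m);
  faceh_facev : forall m n (i : 'I_n.+2) (j : 'I_m.+2) x,
    face (horiz m) i (face (vert n.+1) j x) =
    face (vert n) j (face (horiz m.+1) i x);
  faceh_degenv : forall m n (i : 'I_n.+2) (j : 'I_m.+1) x,
    face (horiz m.+1) i (degen (vert n.+1) j x) =
    degen (vert n) j (face (horiz m) i x);
  degenh_facev : forall m n (i : 'I_n.+1) (j : 'I_m.+2) x,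
    degen (horiz m) i (face (vert n) j x) =
    face (vert n.+1) j (degen (horiz m.+1) i x);
  degenh_degenv : forall m n (i : 'I_n.+1) (j : 'I_m.+1) x,
    degen (horiz m.+1) i (degen (vert n) j x) =
    degen (vert n.+1) j (degen (horiz m) i x)
}.

Definition is_sset_map (X Y : sset) (f : forall n, X n -> Y n) : Prop :=
  (forall n (i : 'I_n.+2) (x : X n.+1), f n (face X i x) = face Y i (f n.+1 x))
  /\
  (forall n (j : 'I_n.+1) (x : X n), f n.+1 (degen X j x) = degen Y j (f n x)).

Definition is_sset_iso (X Y : sset) (f : forall n, X n -> Y n) : Prop :=
  is_sset_map f /\
  exists g : forall n, Y n -> X n,
    is_sset_map g /\ (forall n, cancel (f n) (g n) /\ cancel (g n) (f n)).

Record bisset_map (K L : bisset) := BiSSetMap {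
  bimap :> forall m n, K m n -> L m n;
  bimap_facev : forall m n (i : 'I_m.+2) x,
    bimap (face (vert K n) i x) = face (vert L n) i (bimap x);
  bimap_degenv : forall m n (i : 'I_m.+1) x,
    bimap (degen (vert K n) i x) = degen (vert L n) i (bimap x);
  bimap_faceh : forall m n (i : 'I_n.+2) x,
    bimap (face (horiz K m) i x) = face (horiz L m) i (bimap x);
  bimap_degenh : forall m n (i : 'I_n.+1) x,
    bimap (degen (horiz K m) i x) = degen (horiz L m) i (bimap x)
}.

Definition presheaf_simplicial (X : nat -> Type)
  (act : forall m n, mono m n -> X n -> X m)
  (act_id : forall n x, act n n (mid n) x = x)
  (act_comp : forall l m n (u : mono m n) (v : mono l m) x,
     act l n (mcomp u v) x = act l m v (act m n u x)) : simplicial X.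
Proof.
refine (@Simplicial X (fun n i => act n n.+1 (coface i))
  (fun n j => act n.+1 n (codegen j)) _ _ _ _ _ _).
- abstract (move=> n i j x h; rewrite -!act_comp; congr act;
  apply: mono_eq => k; rewrite !mcompE !(coface_val, codegen_val) /=; try lia;
  by do !case: ifP; lia).
- abstract (move=> n i j x h; rewrite -!act_comp; congr act;
  apply: mono_eq => k; rewrite !mcompE !(coface_val, codegen_val) /=; try lia;
  by do !case: ifP; lia).
- abstract (move=> n i j x h; rewrite -!act_comp; congr act;
  apply: mono_eq => k; rewrite !mcompE !(coface_val, codegen_val) /=; try lia;
  by do !case: ifP; lia).
- abstract (move=> n j x h; rewrite -!act_comp -[RHS]act_id; congr act;
  apply: mono_eq => k; rewrite !mcompE !(coface_val, codegen_val) /=; try lia;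
  by do !case: ifP; lia).
- abstract (move=> n j x h; rewrite -!act_comp -[RHS]act_id; congr act;
  apply: mono_eq => k; rewrite !mcompE !(coface_val, codegen_val) /=; try lia;
  by do !case: ifP; lia).
- abstract (move=> n i j x h; rewrite -!act_comp; congr act;
  apply: mono_eq => k; rewrite !mcompE !(coface_val, codegen_val) /=; try lia;
  by do !case: ifP; lia).
Defined.

Lemma ordF_id n : ordF (mid n) = fid (ordcat n).
Proof. by apply: functor_eq => f; apply: sub_eq => /=; case: (sval f). Qed.

Lemma ordF_comp l m n (u : mono m n) (v : mono l m) :
  ordF (mcomp u v) = fcomp (ordF u) (ordF v).
Proof. by apply: functor_eq => f; apply: sub_eq. Qed.

Lemma fcomp_fid C D (F : functor C D) : fcomp F (fid C) = F.
Proof. by apply: functor_eq => f /=. Qed.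

Lemma fcompA A B C D (F : functor C D) (G : functor B C) (H : functor A B) :
  fcomp F (fcomp G H) = fcomp (fcomp F G) H.
Proof. by apply: functor_eq => f /=. Qed.

Definition nerve (E : category) : sset.
Proof.
exists (fun n => functor (ordcat n) E).
apply: (@presheaf_simplicial _ (fun m n u x => fcomp x (ordF u))).
- abstract (by move=> n x; rewrite ordF_id fcomp_fid).
- abstract (by move=> l m n u v x; rewrite ordF_comp fcompA).
Defined.

(* An n-simplex is a family (x_a) with x_a in K_{a,n-a}; writing b for n - a,
   it is indexed by the pairs (a, b) with a + b = n. *)
Definition codiag_fam (K : bisset) (n : nat) : Type :=
  forall a b, a + b = n -> K a b.

Definition codiag_compat (K : bisset) n (x : codiag_fam K n) : Prop :=
  forall a b (e : a + b.+1 = n) (e' : a.+1 + b = n),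
    face (horiz K a) (inord 0) (x a b.+1 e) =
    face (vert K b) (inord a.+1) (x a.+1 b e').

Definition codiag_cell (K : bisset) (n : nat) : Type :=
  {x : codiag_fam K n | codiag_compat x}.

Lemma addSn_eq a b n : a + b = n -> a.+1 + b = n.+1.
Proof. by move<-. Qed.
Lemma addnS_eq a b n : a + b = n -> a + b.+1 = n.+1.
Proof. by move<-; rewrite addnS. Qed.
Lemma addSn_inj a b n : a.+1 + b = n.+1 -> a + b = n.
Proof. by case. Qed.
Lemma addnS_inj a b n : a + b.+1 = n.+1 -> a + b = n.
Proof. by rewrite addnS; case. Qed.

(* The component at (a, b) is d^h_{i-a} x_a if a < i and d^v_i x_{a+1}
   otherwise. *)
Definition codiag_face_fam (K : bisset) n (i : nat) (x : codiag_fam K n.+1) :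
    codiag_fam K n :=
  fun a b e =>
    if a < i then face (horiz K a) (inord (i - a)) (x a b.+1 (addnS_eq e))
    else face (vert K b) (inord i) (x a.+1 b (addSn_eq e)).

(* The component at (a, b) is s^h_{j-a} x_a if a <= j, which forces b > 0, and
   s^v_j x_{a-1} if a > j. *)
Definition codiag_degen_fam (K : bisset) n (j : nat) (x : codiag_fam K n) :
    codiag_fam K n.+1 :=
  fun a b =>
    match a, b return a + b = n.+1 -> K a b with
    | 0, 0 => fun e => False_rect _ (O_S n e)
    | 0, b'.+1 => fun e =>
        degen (horiz K 0) (inord j) (x 0 b' (addnS_inj e))
    | a'.+1, 0 => fun e =>
        degen (vert K 0) (inord j) (x a' 0 (addSn_inj e))
    | a'.+1, b'.+1 => fun e =>
        if a'.+1 <= j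
        then degen (horiz K a'.+1) (inord (j - a'.+1))
               (x a'.+1 b' (addnS_inj e))
        else degen (vert K b'.+1) (inord j) (x a' b'.+1 (addSn_inj e))
    end.

Lemma fam_irr (K : bisset) n (x : codiag_fam K n) a b (e e' : a + b = n) :
  x a b e = x a b e'.
Proof. by congr x; apply: Prop_irrelevance. Qed.

Lemma codiag_face_lt K n i (x : codiag_fam K n.+1) a b e e' : a < i ->
  @codiag_face_fam K n i x a b e =
  face (horiz K a) (inord (i - a)) (x a b.+1 e').
Proof. by rewrite /codiag_face_fam => ->; rewrite (fam_irr x _ e'). Qed.

Lemma codiag_face_ge K n i (x : codiag_fam K n.+1) a b e e' : i <= a ->
  @codiag_face_fam K n i x a b e =
  face (vert K b) (inord i) (x a.+1 b e').
Proof.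
by rewrite /codiag_face_fam ltnNge => ->; rewrite (fam_irr x _ e').
Qed.

Lemma codiag_degen_le K n j (x : codiag_fam K n) a b e e' : a <= j ->
  @codiag_degen_fam K n j x a b.+1 e =
  degen (horiz K a) (inord (j - a)) (x a b e').
Proof.
case: a e e' => [|a] e e' h /=; first by rewrite subn0 (fam_irr x _ e').
by rewrite h (fam_irr x _ e').
Qed.

Lemma codiag_degen_gt K n j (x : codiag_fam K n) a b e e' : j <= a ->
  @codiag_degen_fam K n j x a.+1 b e = degen (vert K b) (inord j) (x a b e').
Proof.
case: b e e' => [|b] e e' h /=; first by rewrite (fam_irr x _ e').
by rewrite ltnNge h (fam_irr x _ e').
Qed.

Lemma codiag_face_compat K n i (x : codiag_fam K n.+1) : i <= n.+1 ->
  codiag_compat x -> codiag_compat (codiag_face_fam i x).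
Proof.
move=> hi hx a b e e'.
have e1 : a + b.+2 = n.+1 by lia.
have e2 : a.+1 + b.+1 = n.+1 by lia.
have e3 : a.+2 + b = n.+1 by lia.
have [h|[h|h]] : a.+1 < i \/ i <= a \/ i = a.+1 by lia.
- rewrite (codiag_face_lt x e e1) 1?(codiag_face_lt x e' e2); try lia.
  rewrite face_face; last lia.
  by rewrite (hx _ _ e1 e2) faceh_facev subnS.
- rewrite (codiag_face_ge x e e2) 1?(codiag_face_ge x e' e3); try lia.
  by rewrite faceh_facev (hx _ _ e2 e3) face_face; last lia.
- subst i; rewrite (codiag_face_lt x e e1) 1?(codiag_face_ge x e' e3); try lia.
  have -> : a.+1 - a = 1 by lia.
  rewrite face_face /=; last lia.
  rewrite (hx _ _ e1 e2) faceh_facev (hx _ _ e2 e3) face_face //; lia.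
Qed.

Lemma codiag_degen_compat K n j (x : codiag_fam K n) : j <= n ->
  codiag_compat x -> codiag_compat (codiag_degen_fam j x).
Proof.
move=> hj hx a b e e'.
have e1 : a + b = n by lia.
have [h|[h|h]] : a.+1 <= j \/ j < a \/ a = j by lia.
- case: b e e' e1 => [|b] e e' e1; first lia.
  have e2 : a.+1 + b = n by lia.
  rewrite (codiag_degen_le x e e1) 1?(codiag_degen_le x e' e2); try lia.
  rewrite face_degen_lt; last lia.
  by rewrite (hx _ _ e1 e2) degenh_facev subnS.
- case: a e e' e1 h => [|a] e e' e1 h; first lia.
  have e2 : a + b.+1 = n by lia.
  rewrite (codiag_degen_gt x e e2) 1?(codiag_degen_gt x e' e1); try lia.
  rewrite faceh_degenv (hx _ _ e2 e1) face_degen_gt //; lia.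
- rewrite (codiag_degen_le x e e1) 1?(codiag_degen_gt x e' e1); try lia.
  by subst a; rewrite subnn face_degen_id // face_degen_idS //; lia.
Qed.

Definition codiag_face K n (i : 'I_n.+2) (x : codiag_cell K n.+1) :
    codiag_cell K n :=
  exist _ (codiag_face_fam i (sval x))
    (codiag_face_compat (leq_ord i) (svalP x)).

Definition codiag_degen K n (j : 'I_n.+1) (x : codiag_cell K n) :
    codiag_cell K n.+1 :=
  exist _ (codiag_degen_fam j (sval x))
    (codiag_degen_compat (leq_ord j) (svalP x)).

Lemma codiag_eq K n (x y : codiag_cell K n) :
  (forall a b e, sval x a b e = sval y a b e) -> x = y.
Proof.
move=> H; apply: sub_eq; apply: functional_extensionality_dep => a.
by apply: functional_extensionality_dep => b; apply: funext => e; apply: H.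
Qed.

Lemma codiag_face_face K n (i j : nat) (x : codiag_cell K n.+2) : i < j <= n.+2 ->
  codiag_face (inord i) (codiag_face (inord j) x) =
  codiag_face (inord j.-1) (codiag_face (inord i) x).
Proof.
case: x => x hx h; apply: codiag_eq => a b e /=; rewrite !inordK; try lia.
have e1 : a + b.+1 = n.+1 by lia.
have e2 : a.+1 + b = n.+1 by lia.
have e3 : a + b.+2 = n.+2 by lia.
have e4 : a.+1 + b.+1 = n.+2 by lia.
have e5 : a.+2 + b = n.+2 by lia.
case: (ltnP a i) => hi; last first.
  rewrite (codiag_face_ge _ e e2) //.
  case: (ltnP a.+1 j) => hj.
    rewrite (codiag_face_lt _ e2 e4) //.
    rewrite (codiag_face_lt _ e e1) 1?(codiag_face_ge _ e1 e4); try lia.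
    by rewrite -faceh_facev; congr (face _ (inord _) _); lia.
  rewrite (codiag_face_ge _ e2 e5) //.
  rewrite (codiag_face_ge _ e e2) 1?(codiag_face_ge _ e2 e5); try lia.
  by rewrite face_face //; lia.
rewrite (codiag_face_lt _ e e1) // (codiag_face_lt _ e1 e3); last lia.
rewrite (codiag_face_lt _ e e1) 1?(codiag_face_lt _ e1 e3); try lia.
by rewrite face_face; [congr (face _ (inord _) _) |]; lia.
Qed.

Lemma codiag_degen_degen K n (i j : nat) (x : codiag_cell K n) : i <= j <= n ->
  codiag_degen (inord i) (codiag_degen (inord j) x) =
  codiag_degen (inord j.+1) (codiag_degen (inord i) x).
Proof.
case: x => x hx h; apply: codiag_eq => a b e /=; rewrite !inordK; try lia.
have [h1|[h1|h1]] : a <= i \/ i < a <= j.+1 \/ j.+1 < a by lia.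
- case: b e => [|[|b]] e; try lia.
  have e1 : a + b.+1 = n.+1 by lia.
  have e2 : a + b = n by lia.
  rewrite (codiag_degen_le _ e e1) 1?(codiag_degen_le _ e1 e2); try lia.
  rewrite (codiag_degen_le _ e e1) 1?(codiag_degen_le _ e1 e2); try lia.
  by rewrite degen_degen; [congr (degen _ (inord _) _) |]; lia.
- case: a b e h1 => [|a] [|b] e h1; try lia.
  have e1 : a + b.+1 = n.+1 by lia.
  have e2 : a + b = n by lia.
  have e3 : a.+1 + b = n.+1 by lia.
  rewrite (codiag_degen_gt _ e e1) 1?(codiag_degen_le _ e1 e2); try lia.
  rewrite (codiag_degen_le _ e e3) 1?(codiag_degen_gt _ e3 e2); try lia.
  by rewrite -degenh_degenv; congr (degen _ (inord _) _); lia.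
- case: a e h1 => [|[|a]] e h1; try lia.
  have e1 : a.+1 + b = n.+1 by lia.
  have e2 : a + b = n by lia.
  rewrite (codiag_degen_gt _ e e1) 1?(codiag_degen_gt _ e1 e2); try lia.
  rewrite (codiag_degen_gt _ e e1) 1?(codiag_degen_gt _ e1 e2); try lia.
  by rewrite degen_degen //; lia.
Qed.

Lemma codiag_face_degen_lt K n (i j : nat) (x : codiag_cell K n.+1) : i < j <= n.+1 ->
  codiag_face (inord i) (codiag_degen (inord j) x) =
  codiag_degen (inord j.-1) (codiag_face (inord i) x).
Proof.
case: x => x hx h; apply: codiag_eq => a b e /=; rewrite !inordK; try lia.
have [h1|[h1|h1]] : a < i \/ i <= a < j \/ j <= a by lia.
- case: b e => [|b] e; try lia.
  have e1 : a + b.+2 = n.+2 by lia.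
  have e2 : a + b = n by lia.
  rewrite (codiag_face_lt _ e e1) 1?(codiag_degen_le _ e1 e); try lia.
  rewrite (codiag_degen_le _ e e2) 1?(codiag_face_lt _ e2 e); try lia.
  by rewrite face_degen_lt; [congr (degen _ (inord _) _) |]; lia.
- case: b e => [|b] e; try lia.
  have e1 : a.+1 + b.+1 = n.+2 by lia.
  have e2 : a + b = n by lia.
  have e3 : a.+1 + b = n.+1 by lia.
  rewrite (codiag_face_ge _ e e1) 1?(codiag_degen_le _ e1 e3); try lia.
  rewrite (codiag_degen_le _ e e2) 1?(codiag_face_ge _ e2 e3); try lia.
  by rewrite -degenh_facev; congr (degen _ (inord _) _); lia.
- case: a e h1 => [|a] e h1; try lia.
  have e1 : a.+2 + b = n.+2 by lia.
  have e2 : a + b = n by lia.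
  rewrite (codiag_face_ge _ e e1) 1?(codiag_degen_gt _ e1 e); try lia.
  rewrite (codiag_degen_gt _ e e2) 1?(codiag_face_ge _ e2 e); try lia.
  by rewrite face_degen_lt //; lia.
Qed.

Lemma codiag_face_degen_id K n (j : nat) (x : codiag_cell K n) : j <= n ->
  codiag_face (inord j) (codiag_degen (inord j) x) = x.
Proof.
case: x => x hx h; apply: codiag_eq => a b e /=; rewrite !inordK; try lia.
have e1 : a + b.+1 = n.+1 by lia.
have e2 : a.+1 + b = n.+1 by lia.
case: (ltnP a j) => h1.
  rewrite (codiag_face_lt _ e e1) // (codiag_degen_le _ e1 e); last lia.
  by rewrite face_degen_id //; lia.
rewrite (codiag_face_ge _ e e2) // (codiag_degen_gt _ e2 e) //.
by rewrite face_degen_id //; lia.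
Qed.

Lemma codiag_face_degen_idS K n (j : nat) (x : codiag_cell K n) : j <= n ->
  codiag_face (inord j.+1) (codiag_degen (inord j) x) = x.
Proof.
case: x => x hx h; apply: codiag_eq => a b e /=; rewrite !inordK; try lia.
have e1 : a + b.+1 = n.+1 by lia.
have e2 : a.+1 + b = n.+1 by lia.
case: (ltnP a j.+1) => h1.
  rewrite (codiag_face_lt _ e e1) // (codiag_degen_le _ e1 e); last lia.
  by rewrite subSn // face_degen_idS //; lia.
rewrite (codiag_face_ge _ e e2) // (codiag_degen_gt _ e2 e); last lia.
by rewrite face_degen_idS //; lia.
Qed.

Lemma codiag_face_degen_gt K n (i j : nat) (x : codiag_cell K n.+1) :
  j.+1 < i <= n.+2 ->
  codiag_face (inord i) (codiag_degen (inord j) x) =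
  codiag_degen (inord j) (codiag_face (inord i.-1) x).
Proof.
case: x => x hx h; apply: codiag_eq => a b e /=; rewrite !inordK; try lia.
have [h1|[h1|h1]] : a <= j \/ j < a < i \/ i <= a by lia.
- case: b e => [|b] e; try lia.
  have e1 : a + b.+2 = n.+2 by lia.
  have e2 : a + b = n by lia.
  rewrite (codiag_face_lt _ e e1) 1?(codiag_degen_le _ e1 e); try lia.
  rewrite (codiag_degen_le _ e e2) 1?(codiag_face_lt _ e2 e); try lia.
  rewrite face_degen_gt; last lia.
  by have -> : (i - a).-1 = i.-1 - a by lia.
- case: a e h1 => [|a] e h1; try lia.
  have e1 : a.+1 + b.+1 = n.+2 by lia.
  have e2 : a + b = n by lia.
  have e3 : a + b.+1 = n.+1 by lia.
  rewrite (codiag_face_lt _ e e1) 1?(codiag_degen_gt _ e1 e3); try lia.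
  rewrite (codiag_degen_gt _ e e2) 1?(codiag_face_lt _ e2 e3); try lia.
  by rewrite faceh_degenv; have -> : i - a.+1 = i.-1 - a by lia.
- case: a e h1 => [|a] e h1; try lia.
  have e1 : a.+2 + b = n.+2 by lia.
  have e2 : a + b = n by lia.
  rewrite (codiag_face_ge _ e e1) 1?(codiag_degen_gt _ e1 e); try lia.
  rewrite (codiag_degen_gt _ e e2) 1?(codiag_face_ge _ e2 e); try lia.
  by rewrite face_degen_gt //; lia.
Qed.

Definition codiag_simplicial (K : bisset) : simplicial (codiag_cell K) :=
  Simplicial (@codiag_face_face K) (@codiag_degen_degen K)
    (@codiag_face_degen_lt K) (@codiag_face_degen_id K)
    (@codiag_face_degen_idS K) (@codiag_face_degen_gt K).

Definition codiag (K : bisset) : sset := SSet (codiag_simplicial K).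

Lemma codiag_map_compat (K L : bisset) (f : bisset_map K L) n
  (x : codiag_cell K n) :
  codiag_compat (fun a b e => f a b (sval x a b e)).
Proof.
by move=> a b e e'; rewrite -bimap_faceh -bimap_facev (svalP x _ _ e e').
Qed.

Definition codiag_map (K L : bisset) (f : bisset_map K L) n
    (x : codiag K n) : codiag L n :=
  exist _ _ (codiag_map_compat f x).

(* Fibrations are covariant: arrows of the base are lifted from a given domain,
   and an arrow is cartesian if it is initial among the arrows with the same
   domain and the same image. *)
Definition cartesian (E B : category) (p : functor E B) (f : arr E) : Prop :=
  forall g : arr E, dom g = dom f -> farr p g = farr p f ->
  exists! h : arr E,
    farr p h = idt (fobj p (cod f)) /\
    exists e : cod f = dom h, cmp h f e = g.

Definition is_prefibration (E B : category) (p : functor E B) : Prop :=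
  forall (e : obj E) (phi : arr B), dom phi = fobj p e ->
  exists f : arr E, [/\ cartesian p f, dom f = e & farr p f = phi].

Definition is_fibration (E B : category) (p : functor E B) : Prop :=
  is_prefibration p /\
  forall (g f : arr E) (e : cod f = dom g),
    cartesian p g -> cartesian p f -> cartesian p (cmp g f e).

Record fibration := Fibration {
  total : category;
  base : category;
  proj : functor total base;
  fibrationP : is_fibration proj
}.

Record cleavage (xi : fibration) := Cleavage {
  cl_arr :> arr (total xi) -> Prop;
  cl_cart : forall f, cl_arr f -> cartesian (proj xi) f;
  cl_lift : forall (e : obj (total xi)) (phi : arr (base xi)),
    dom phi = fobj (proj xi) e ->
    exists! f, [/\ cl_arr f, dom f = e & farr (proj xi) f = phi];
  cl_idt : forall e, cl_arr (idt e)
}.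

Definition closed_cleavage (xi : fibration) (Sigma : cleavage xi) : Prop :=
  forall (g f : arr (total xi)) (e : cod f = dom g),
    Sigma g -> Sigma f -> Sigma (cmp g f e).

Record fibmap (xi xi' : fibration) := FibMap {
  ftot : functor (total xi) (total xi');
  fbase : functor (base xi) (base xi');
  fsquare : fcomp (proj xi') ftot = fcomp fbase (proj xi);
  fcart : forall f, cartesian (proj xi) f -> cartesian (proj xi') (farr ftot f)
}.
Arguments fcart {xi xi'} x [f] _ : rename.

Definition is_cleaved (xi xi' : fibration) (Sigma : cleavage xi)
    (Sigma' : cleavage xi') (x : fibmap xi xi') : Prop :=
  forall f, Sigma f -> Sigma' (farr (ftot x) f).

Definition cleaved_map (xi xi' : fibration) (Sigma : cleavage xi)
    (Sigma' : cleavage xi') : Type :=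
  {x : fibmap xi xi' | is_cleaved Sigma Sigma' x}.

Lemma fibmap_eq (xi xi' : fibration) (x y : fibmap xi xi') :
  ftot x = ftot y -> fbase x = fbase y -> x = y.
Proof.
case: x y => [t b p q] [t' b' p' q'] /= et eb; subst.
by congr FibMap; apply: Prop_irrelevance.
Qed.

Lemma fmcomp_square (xi1 xi2 xi3 : fibration)
  (x : fibmap xi2 xi3) (y : fibmap xi1 xi2) :
  fcomp (proj xi3) (fcomp (ftot x) (ftot y)) =
  fcomp (fcomp (fbase x) (fbase y)) (proj xi1).
Proof. by rewrite fcompA fsquare -fcompA fsquare fcompA. Qed.

Definition fmcomp (xi1 xi2 xi3 : fibration)
    (x : fibmap xi2 xi3) (y : fibmap xi1 xi2) : fibmap xi1 xi3 :=
  FibMap (fmcomp_square x y) (fun f hf => fcart x (fcart y hf)).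

Definition is_idt (C : category) (f : arr C) : Prop := f = idt (dom f).

Lemma is_idt_farr (C D : category) (F : functor C D) f :
  is_idt f -> is_idt (farr F f).
Proof. by move=> hf; rewrite /is_idt farr_dom -farr_idt -hf. Qed.

Lemma ordarr_eq n (f g : arr (ordcat n)) :
  dom f = dom g -> cod f = cod g -> f = g.
Proof.
by case: f g => [[a b] f] [[c d] g] /= e1 e2; apply: sub_eq; rewrite /= e1 e2.
Qed.

Lemma ordarr_le n (f : arr (ordcat n)) :
  (dom f : 'I_n.+1) <= (cod f : 'I_n.+1).
Proof. exact: (svalP f). Qed.

Lemma cartesian_coord (E : category) m n (q : functor E (ordcat m))
  (p : functor E (ordcat n)) :
  (forall f g, farr q f = farr q g -> farr p f = farr p g -> f = g) ->
  (forall f g, dom g = dom f -> farr p g = farr p f -> is_idt (farr q f) ->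
     exists h, [/\ dom h = cod f, farr p h = idt (fobj p (cod f)) &
                   farr q h = farr q g]) ->
  (forall e phi, dom phi = fobj p e ->
     exists f, [/\ is_idt (farr q f), dom f = e & farr p f = phi]) ->
  (forall f, cartesian p f <-> is_idt (farr q f)) /\ is_fibration p.
Proof.
move=> inj fill lift.
have key f : cartesian p f <-> is_idt (farr q f).
  split=> [hf|hf].
    have [g [g1 g2 g3]] := lift (dom f) (farr p f) (farr_dom p f).
    have [h [[_ [e he]] _]] := hf g g2 g3.
    have eq1 : fobj q (cod g) = fobj q (dom f).
      by rewrite -farr_cod g1 cod_idt farr_dom g2.
    apply: ordarr_eq; rewrite ?dom_idt ?cod_idt //.
    have le1 := ordarr_le (farr q f); have le2 := ordarr_le (farr q h).
    have ecod : cod h = cod g by rewrite -he cod_cmp.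
    move: le1 le2; rewrite !farr_dom !farr_cod -e ecod eq1 => le1 le2.
    by apply: val_inj; apply/eqP; rewrite eqn_leq le1 le2.
  move=> g g1 g2; have [h [h1 h2 h3]] := fill f g g1 g2 hf.
  have qf : fobj q (cod f) = fobj q (dom f) by rewrite -farr_cod hf cod_idt farr_dom.
  exists h; split.
    split=> //; exists (esym h1); apply: inj.
      rewrite (farr_cmp _ (farr_composable q (esym h1))) -h3.
      apply: ordarr_eq; rewrite ?dom_cmp ?cod_cmp //.
      by rewrite !farr_dom h1 qf.
    rewrite (farr_cmp _ (farr_composable p (esym h1))) g2.
    apply: ordarr_eq; rewrite ?dom_cmp ?cod_cmp //.
    by rewrite h2 cod_idt farr_cod.
  move=> h' [p1 [e he]]; apply: inj; last by rewrite h2 p1.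
  rewrite h3 -he (farr_cmp _ (farr_composable q e)).
  apply: ordarr_eq; rewrite ?dom_cmp ?cod_cmp //.
  by rewrite !farr_dom -e qf.
split=> //; split.
  move=> e phi h; have [f [f1 f2 f3]] := lift e phi h.
  by exists f; split=> //; apply/key.
move=> g f e /key hg /key hf; apply/key.
rewrite (farr_cmp _ (farr_composable q e)).
rewrite /is_idt dom_cmp; apply: ordarr_eq; rewrite ?dom_idt ?dom_cmp //.
rewrite cod_cmp cod_idt hg cod_idt -(farr_composable q e).
by rewrite [in LHS]hf cod_idt.
Qed.

Lemma square_coord m n :
  (forall f, cartesian (pr2 (ordcat m) (ordcat n)) f <->
             is_idt (farr (pr1 (ordcat m) (ordcat n)) f)) /\
  is_fibration (pr2 (ordcat m) (ordcat n)).
Proof.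
apply: cartesian_coord.
- by move=> [f f'] [g g'] /= -> ->.
- move=> [f f'] [g g'] e1 e2 e3.
  exists (g, idt (cod f')); split=> //.
  have {e3} e3 : f = idt (dom f) := e3.
  have {e1} e1 : dom g = dom f := congr1 fst e1.
  have e4 : cod f = dom f by rewrite [in LHS]e3.
  by congr pair; rewrite e4.
- move=> [a b] phi /= <-.
  by exists (idt a, phi).
Qed.

Definition square m n : fibration := Fibration (proj2 (square_coord m n)).

Definition square_arr m n (f : arr (prodcat (ordcat m) (ordcat n))) : Prop :=
  is_idt (farr (pr1 (ordcat m) (ordcat n)) f).

Lemma square_cleavage_lift m n (e : obj (prodcat (ordcat m) (ordcat n)))
  (phi : arr (ordcat n)) : dom phi = fobj (pr2 (ordcat m) (ordcat n)) e ->
  exists! f, [/\ square_arr f, dom f = e &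
                 farr (pr2 (ordcat m) (ordcat n)) f = phi].
Proof.
case: e => a b /= h; exists (idt a, phi); split=> //=.
  by split=> //; rewrite h.
move=> [f f'] [h1 [h2 _] h3]; congr pair; last exact: esym h3.
by rewrite -h2; exact: esym h1.
Qed.

Definition square_cleavage m n : cleavage (square m n) :=
  @Cleavage (square m n) (@square_arr m n)
    (fun f hf => proj2 (proj1 (square_coord m n) f) hf)
    (@square_cleavage_lift m n) (fun x => erefl).

Lemma square_map_square m n m' n' (u : mono m m') (v : mono n n') :
  fcomp (proj (square m' n')) (fprod (ordF u) (ordF v)) =
  fcomp (ordF v) (proj (square m n)).
Proof. by apply: functor_eq => f /=. Qed.

Lemma square_map_idt m n m' n' (u : mono m m') (v : mono n n') f :
  square_arr f -> square_arr (farr (fprod (ordF u) (ordF v)) f).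
Proof.
exact: (is_idt_farr (ordF u)).
Qed.

Lemma square_map_cart m n m' n' (u : mono m m') (v : mono n n') f :
  cartesian (proj (square m n)) f ->
  cartesian (proj (square m' n')) (farr (fprod (ordF u) (ordF v)) f).
Proof.
move=> /(proj1 (square_coord m n)) hf.
by apply/(proj1 (square_coord m' n')); apply: square_map_idt.
Qed.

Definition square_map m n m' n' (u : mono m m') (v : mono n n') :
    fibmap (square m n) (square m' n') :=
  @FibMap (square m n) (square m' n') (fprod (ordF u) (ordF v)) (ordF v)
    (square_map_square u v) (@square_map_cart _ _ _ _ u v).

Definition tri_pred n : pred (obj (prodcat (ordcat n) (ordcat n))) :=
  fun x : 'I_n.+1 * 'I_n.+1 => x.1 <= x.2.

Definition tricat n : category := fullsub (@tri_pred n).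

Definition tri_proj n : functor (tricat n) (ordcat n) :=
  fcomp (pr2 (ordcat n) (ordcat n)) (incl (@tri_pred n)).

Definition tri_fst n : functor (tricat n) (ordcat n) :=
  fcomp (pr1 (ordcat n) (ordcat n)) (incl (@tri_pred n)).

Lemma tri_arr_eq n (f g : arr (tricat n)) :
  farr (tri_fst n) f = farr (tri_fst n) g ->
  farr (tri_proj n) f = farr (tri_proj n) g -> f = g.
Proof.
case: f g => [[f f'] hf] [[g g'] hg] /= e1 e2.
by apply: sub_eq; rewrite /= e1 e2.
Qed.

Lemma tri_coord n :
  (forall f, cartesian (tri_proj n) f <-> is_idt (farr (tri_fst n) f)) /\
  is_fibration (tri_proj n).
Proof.
apply: cartesian_coord.
- exact: tri_arr_eq.
- move=> [[f f'] hf] [[g g'] hg] e1 e2 e3.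
  have {e3} e3 : f = idt (dom f) := e3.
  have {e2} e2 : g' = f' := e2.
  have {e1} e1 : dom g = dom f := congr1 (fun x => (sval x).1) e1.
  have hp : tri_pred (dom ((g, idt (cod f')) : arr (prodcat (ordcat n) (ordcat n)))) &&
            tri_pred (cod ((g, idt (cod f')) : arr (prodcat (ordcat n) (ordcat n)))).
    case/andP: hf hg; rewrite /tri_pred => h1 h2 /andP [_ h3].
    apply/andP; split; last by rewrite -e2.
    by move: e1 => /= ->; apply: leq_trans h1 (svalP f').
  exists (exist _ (g, idt (cod f')) hp); split=> //.
  have e4 : cod f = dom f by rewrite [in LHS]e3.
  by apply: sub_eq; congr pair; rewrite e4.
- move=> [[a b] hab] phi /= h.
  have hp : tri_pred (dom ((idt a, phi) : arr (prodcat (ordcat n) (ordcat n)))) &&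
            tri_pred (cod ((idt a, phi) : arr (prodcat (ordcat n) (ordcat n)))).
    rewrite /tri_pred /= in hab *; rewrite h hab /=.
    by apply: leq_trans hab _; rewrite -h; exact: (svalP phi).
  exists (exist _ (idt a, phi) hp); split=> //=.
  by apply: sub_eq; rewrite /= h.
Qed.

Definition tri n : fibration := Fibration (proj2 (tri_coord n)).

Definition fmid (xi : fibration) : fibmap xi xi.
Proof.
refine (@FibMap xi xi (fid _) (fid _) _ (fun f hf => hf)).
abstract (by apply: functor_eq => f /=).
Defined.

Lemma fmcomp_id (xi xi' : fibration) (x : fibmap xi xi') :
  fmcomp x (fmid xi) = x.
Proof. by apply: fibmap_eq; apply: functor_eq => f /=. Qed.

Lemma fmcompA (xi1 xi2 xi3 xi4 : fibration) (x : fibmap xi3 xi4)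
  (y : fibmap xi2 xi3) (z : fibmap xi1 xi2) :
  fmcomp x (fmcomp y z) = fmcomp (fmcomp x y) z.
Proof. by apply: fibmap_eq; apply: functor_eq => f /=. Qed.

Lemma square_map_id m n : square_map (mid m) (mid n) = fmid (square m n).
Proof.
apply: fibmap_eq; last exact: ordF_id.
by apply: functor_eq => -[f g] /=; congr pair; apply: ordarr_eq.
Qed.

Lemma square_map_comp m n m' n' m'' n'' (u : mono m' m'') (v : mono n' n'')
  (u' : mono m m') (v' : mono n n') :
  square_map (mcomp u u') (mcomp v v') =
  fmcomp (square_map u v) (square_map u' v').
Proof.
apply: fibmap_eq; last exact: ordF_comp.
by apply: functor_eq => -[f g] /=; congr pair; apply: ordarr_eq.
Qed.

Lemma mcomp_idl m n (u : mono m n) : mcomp (mid n) u = u.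
Proof. exact: mono_eq. Qed.
Lemma mcomp_idr m n (u : mono m n) : mcomp u (mid m) = u.
Proof. exact: mono_eq. Qed.

Lemma square_map_swap m n m' n' (u : mono m m') (v : mono n n') :
  fmcomp (square_map u (mid n')) (square_map (mid m) v) =
  fmcomp (square_map (mid m') v) (square_map u (mid n)).
Proof. by rewrite -!square_map_comp !mcomp_idl !mcomp_idr. Qed.

Definition fnerve_cell (xi : fibration) m n : Type := fibmap (square m n) xi.

Definition fnerve_vert xi n : simplicial (fun m => fnerve_cell xi m n).
Proof.
apply: (@presheaf_simplicial _
  (fun m m' u (x : fnerve_cell xi m' n) => fmcomp x (square_map u (mid n)))).
- abstract (by move=> m x; rewrite square_map_id fmcomp_id).
- abstract (by move=> l m m' u v x; rewrite -fmcompA -square_map_comp mcomp_idl).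
Defined.

Definition fnerve_horiz xi m : simplicial (fnerve_cell xi m).
Proof.
apply: (@presheaf_simplicial _
  (fun n n' v (x : fnerve_cell xi m n') => fmcomp x (square_map (mid m) v))).
- abstract (by move=> n x; rewrite square_map_id fmcomp_id).
- abstract (by move=> l n n' u v x; rewrite -fmcompA -square_map_comp mcomp_idl).
Defined.

Definition fnerve (xi : fibration) : bisset.
Proof.
refine (@BiSSet (fnerve_cell xi) (fnerve_vert xi) (fnerve_horiz xi) _ _ _ _);
  abstract (by move=> m n i j x; rewrite /= -!fmcompA square_map_swap).
Defined.

Definition cnerve_cell (xi : fibration) (Sigma : cleavage xi) m n : Type := cleaved_map (square_cleavage m n) Sigma.

Lemma square_map_cleaved xi (Sigma : cleavage xi) m n m' n' (u : mono m m') (v : mono n n')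
  (x : cnerve_cell Sigma m' n') :
  is_cleaved (square_cleavage m n) Sigma (fmcomp (sval x) (square_map u v)).
Proof. by move=> f hf; apply: (svalP x); apply: square_map_idt. Qed.

Definition cnerve_act xi (Sigma : cleavage xi) m n m' n' (u : mono m m') (v : mono n n')
    (x : cnerve_cell Sigma m' n') : cnerve_cell Sigma m n :=
  exist _ (fmcomp (sval x) (square_map u v)) (square_map_cleaved u v x).

Definition cnerve_vert xi (Sigma : cleavage xi) n :
    simplicial (fun m => cnerve_cell Sigma m n).
Proof.
apply: (@presheaf_simplicial _
  (fun m m' u (x : cnerve_cell Sigma m' n) => cnerve_act u (mid n) x)).
- abstract (by move=> m x; apply: sub_eq; rewrite /= square_map_id fmcomp_id).
- abstract (move=> l m m' u v x; apply: sub_eq;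
  by rewrite /= -fmcompA -square_map_comp mcomp_idl).
Defined.

Definition cnerve_horiz xi (Sigma : cleavage xi) m :
    simplicial (cnerve_cell Sigma m).
Proof.
apply: (@presheaf_simplicial _
  (fun n n' v (x : cnerve_cell Sigma m n') => cnerve_act (mid m) v x)).
- abstract (by move=> n x; apply: sub_eq; rewrite /= square_map_id fmcomp_id).
- abstract (move=> l n n' u v x; apply: sub_eq;
  by rewrite /= -fmcompA -square_map_comp mcomp_idl).
Defined.

Definition cnerve (xi : fibration) (Sigma : cleavage xi) : bisset.
Proof.
refine (@BiSSet (cnerve_cell Sigma) (cnerve_vert Sigma) (cnerve_horiz Sigma) _ _ _ _);
  abstract (by move=> m n i j x; apply: sub_eq;
    rewrite /= -!fmcompA square_map_swap).
Defined.

Definition cnerve_incl (xi : fibration) (Sigma : cleavage xi) :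
  bisset_map (cnerve Sigma) (fnerve xi).
Proof. by exists (fun m n (x : cnerve_cell Sigma m n) => sval x). Defined.

Lemma alpha_fst_proof r s n (e : r + s = n) (a : 'I_r.+1) : a < n.+1.
Proof. by rewrite -e; have := ltn_ord a; lia. Qed.
Lemma alpha_snd_proof r s n (e : r + s = n) (b : 'I_s.+1) : b + r < n.+1.
Proof. by rewrite -e; have := ltn_ord b; lia. Qed.

Definition alpha_fst r s n (e : r + s = n) : mono r n.
Proof. by exists (fun a => Ordinal (alpha_fst_proof e a)). Defined.

Definition alpha_snd r s n (e : r + s = n) : mono s n.
Proof.
exists (fun b => Ordinal (alpha_snd_proof e b)).
abstract (by move=> x y h; rewrite /= leq_add2r).
Defined.

Lemma alpha_tri r s n (e : r + s = n) (x : obj (prodcat (ordcat r) (ordcat s))) :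
  tri_pred (fobj (fprod (ordF (alpha_fst e)) (ordF (alpha_snd e))) x).
Proof.
case: x => a b; rewrite /tri_pred /=.
by rewrite (leq_trans (leq_ord a)) // leq_addl.
Qed.

(* (a, b) |-> (a, b + r) on total categories, b |-> b + r on bases. *)
Definition alpha r s n (e : r + s = n) : fibmap (square r s) (tri n).
Proof.
refine (@FibMap (square r s) (tri n) (corestrict (alpha_tri e))
          (ordF (alpha_snd e)) _ _).
- abstract (by apply: functor_eq => f /=).
- abstract (move=> f /(proj1 (square_coord r s)) hf;
  apply/(proj1 (tri_coord n)); exact: (is_idt_farr (ordF (alpha_fst e)) hf)).
Defined.

Lemma alpha_compat r s n (e : r + s.+1 = n) (e' : r.+1 + s = n) :
  fmcomp (alpha e) (square_map (mid r) (coface (inord 0))) =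
  fmcomp (alpha e') (square_map (coface (inord r.+1)) (mid s)).
Proof.
have es (a : 'I_s.+1) : lift (inord 0) a + r = a + r.+1 :> nat.
  by rewrite /= inordK // /bump leq0n addSnnS.
have er (a : 'I_r.+1) : a = lift (inord r.+1) a :> nat.
  by rewrite /= inordK // /bump leqNgt ltn_ord.
apply: fibmap_eq; apply: functor_eq.
  case=> f g; apply: tri_arr_eq; apply: ordarr_eq; apply: val_inj; rewrite /= ?es //;
  exact: er.
by move=> f; apply: ordarr_eq; apply: val_inj; apply: es.
Qed.

Lemma tri_codiag_compat (xi : fibration) n (x : fibmap (tri n) xi) :
  @codiag_compat (fnerve xi) n (fun a b e => fmcomp x (alpha e)).
Proof.
move=> a b e e'; rewrite /= -!fmcompA; congr fmcomp; exact: alpha_compat.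
Qed.

(* x |-> (x alpha^0, ..., x alpha^n); its inverse is [glue] below. *)
Definition tri_codiag (xi : fibration) n (x : fibmap (tri n) xi) :
    codiag (fnerve xi) n :=
  exist _ _ (tri_codiag_compat x).

(* Composition made total, to be rewritten without dependent proofs. *)
Definition tcmp (C : category) (g f : arr C) : arr C :=
  match pselect (cod f = dom g) with left e => cmp g f e | right _ => f end.

Lemma tcmpE (C : category) (g f : arr C) e : cmp g f e = tcmp g f.
Proof. by rewrite /tcmp; case: pselect => // e'; apply: cmp_eq. Qed.

Lemma dom_tcmp (C : category) (g f : arr C) :
  cod f = dom g -> dom (tcmp g f) = dom f.
Proof. by move=> e; rewrite -tcmpE dom_cmp. Qed.

Lemma cod_tcmp (C : category) (g f : arr C) :
  cod f = dom g -> cod (tcmp g f) = cod g.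
Proof. by move=> e; rewrite -tcmpE cod_cmp. Qed.

Lemma tcmpA (C : category) (h g f : arr C) :
  cod f = dom g -> cod g = dom h -> tcmp h (tcmp g f) = tcmp (tcmp h g) f.
Proof.
move=> e1 e3.
have e2 : cod (cmp g f e1) = dom h by rewrite cod_cmp.
have e4 : cod f = dom (cmp h g e3) by rewrite dom_cmp.
have := cmpA e2 e4; rewrite (tcmpE e2) (tcmpE e4).
by rewrite !tcmpE.
Qed.

Lemma tcmp_idl (C : category) x (f : arr C) : cod f = x -> tcmp (idt x) f = f.
Proof.
move=> e; have e' : cod f = dom (idt x) by rewrite dom_idt.
by rewrite -(tcmpE e') cmp_idl.
Qed.

Lemma tcmp_idr (C : category) x (f : arr C) : dom f = x -> tcmp f (idt x) = f.
Proof.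
move=> e; have e' : cod (idt x) = dom f by rewrite cod_idt.
by rewrite -(tcmpE e') cmp_idr.
Qed.

Lemma farr_tcmp (C D : category) (F : functor C D) (g f : arr C) :
  cod f = dom g -> farr F (tcmp g f) = tcmp (farr F g) (farr F f).
Proof.
by move=> e; rewrite -(tcmpE e) (farr_cmp e (farr_composable F e)) tcmpE.
Qed.

(* Objects and arrows of [ordcat n] indexed by natural numbers, values beyond n
   being truncated to n. *)
Definition clip n (a : nat) : 'I_n.+1 := inord (minn a n).

Lemma clipE n a : clip n a = minn a n :> nat.
Proof. by rewrite inordK // ltnS geq_minr. Qed.

Lemma clip_ord n (a : 'I_n.+1) : clip n a = a.
Proof. by apply: val_inj; rewrite /= clipE; apply/minn_idPl; rewrite -ltnS. Qed.

Lemma oarr_proof n a b : clip n (minn a b) <= clip n b.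
Proof. by rewrite !clipE; lia. Qed.

Definition oarr n (a b : nat) : arr (ordcat n) :=
  exist _ (clip n (minn a b), clip n b) (oarr_proof n a b).

Lemma dom_oarr n a b : a <= b -> dom (oarr n a b) = clip n a.
Proof. by move=> h /=; rewrite (minn_idPl h). Qed.

Lemma oarr_id n a : oarr n a a = idt (clip n a : obj (ordcat n)).
Proof. by apply: ordarr_eq => //=; rewrite minnn. Qed.

Lemma is_idt_oarr n a : is_idt (oarr n a a).
Proof. by rewrite /is_idt dom_oarr // -oarr_id. Qed.

Lemma oarr_ord n (f : arr (ordcat n)) :
  f = oarr n (dom f : 'I_n.+1) (cod f : 'I_n.+1).
Proof.
apply: ordarr_eq; first by rewrite dom_oarr ?clip_ord //; exact: ordarr_le.
by rewrite /= -[LHS]clip_ord.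
Qed.

Lemma oarr_cmp n a b c : a <= b <= c ->
  tcmp (oarr n b c) (oarr n a b) = oarr n a c.
Proof.
case/andP=> h1 h2.
have e : cod (oarr n a b) = dom (oarr n b c) by rewrite dom_oarr.
rewrite -(tcmpE e); apply: ordarr_eq; rewrite ?dom_cmp ?cod_cmp //.
by rewrite !dom_oarr // (leq_trans h1).
Qed.

Lemma ordF_oarr m n (u : mono m n) a b c d : a <= b <= m -> c <= d ->
  u (clip m a) = minn c n :> nat -> u (clip m b) = minn d n :> nat ->
  farr (ordF u) (oarr m a b) = oarr n c d.
Proof.
move=> /andP [h1 h2] h3 e1 e2; apply: ordarr_eq; apply: val_inj.
  by rewrite farr_dom !dom_oarr //= e1 clipE.
by rewrite farr_cod /= e2 clipE.
Qed.

Section Glue.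
Variables (xi : fibration) (n : nat) (y : codiag (fnerve xi) n).

Definition YT r s (e : r + s = n) a a' c c' : arr (total xi) :=
  farr (ftot (sval y r s e))
    ((oarr r a a', oarr s c c') : arr (prodcat (ordcat r) (ordcat s))).

Definition YB r s (e : r + s = n) c c' : arr (base xi) :=
  farr (fbase (sval y r s e)) (oarr s c c').

Lemma square_map_oarr m k m' k' (u : mono m m') (v : mono k k')
  a a' c c' b b' d d' :
  a <= a' <= m -> b <= b' ->
  u (clip m a) = minn b m' :> nat -> u (clip m a') = minn b' m' :> nat ->
  c <= c' <= k -> d <= d' ->
  v (clip k c) = minn d k' :> nat -> v (clip k c') = minn d' k' :> nat ->
  farr (ftot (square_map u v))
    ((oarr m a a', oarr k c c') : arr (prodcat (ordcat m) (ordcat k))) =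
  (oarr m' b b', oarr k' d d').
Proof.
move=> h1 h2 h3 h4 h5 h6 h7 h8.
by congr pair; apply: ordF_oarr.
Qed.

Lemma YT_compat r s e e' a a' c c' : a <= a' <= r -> c <= c' <= s ->
  @YT r s.+1 e a a' c.+1 c'.+1 = @YT r.+1 s e' a a' c c'.
Proof.
move=> h1 h2.
have := svalP y r s e e' => /(congr1 (fun x : fibmap (square r s) xi => farr (ftot x)
  ((oarr r a a', oarr s c c') : arr (prodcat (ordcat r) (ordcat s))))).
move=> H.
have {H} H : farr (ftot (sval y r s.+1 e))
   (farr (ftot (square_map (mid r) (coface (inord 0))))
    ((oarr r a a', oarr s c c') : arr (prodcat (ordcat r) (ordcat s)))) =
  farr (ftot (sval y r.+1 s e'))
   (farr (ftot (square_map (coface (inord r.+1)) (mid s)))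
    ((oarr r a a', oarr s c c') : arr (prodcat (ordcat r) (ordcat s)))) := H.
move: H.
rewrite (@square_map_oarr _ _ _ _ _ _ _ _ _ _ a a' c.+1 c'.+1);
  rewrite ?[mid _ _]/= ?coface_val ?clipE; try lia.
rewrite (@square_map_oarr _ _ _ _ _ _ _ _ _ _ a a' c c');
  rewrite ?[mid _ _]/= ?coface_val ?clipE; try lia.
1: by [].
all: by rewrite ?leq0n 1?ltnNge ?geq_minr /=; lia.
Qed.

Lemma YB_compat r s e e' c c' : c <= c' <= s ->
  @YB r s.+1 e c.+1 c'.+1 = @YB r.+1 s e' c c'.
Proof.
move=> h2.
have := svalP y r s e e' => /(congr1 (fun x : fibmap (square r s) xi => farr (fbase x) (oarr s c c'))).
move=> H.
have {H} H : farr (fbase (sval y r s.+1 e))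
   (farr (ordF (coface (inord 0))) (oarr s c c')) =
  farr (fbase (sval y r.+1 s e'))
   (farr (ordF (mid s)) (oarr s c c')) := H.
move: H.
rewrite (@ordF_oarr _ _ _ _ _ c.+1 c'.+1);
  rewrite ?coface_val ?clipE; try lia.
1: by rewrite ordF_id.
all: by rewrite ?leq0n 1?ltnNge ?geq_minr /=; lia.
Qed.

Lemma YT_shift r r' s s' e e' a a' c1 c1' c2 c2' :
  r <= r' -> a <= a' <= r -> c1 <= c1' <= s ->
  c1 + r = c2 + r' -> c1' + r = c2' + r' ->
  @YT r s e a a' c1 c1' = @YT r' s' e' a a' c2 c2'.
Proof.
move=> h; rewrite -(subnKC h) in e' *; move: (r' - r) e' => k {h r'}.
elim: k => [|k IH] in r s e a a' c1 c1' c2 c2' *.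
  rewrite addn0 => e' h1 h2 h3 h4.
  have ? : s = s' by lia.
  have -> : c1 = c2 by lia.
  have -> : c1' = c2' by lia.
  subst s'; congr YT; exact: Prop_irrelevance.
case: s e => [|s] e e' h1 h2 h3 h4; first lia.
case: c1 c1' h2 h3 h4 => [|c1] [|c1'] h2 h3 h4; try lia.
have e1 : r.+1 + s = n by lia.
rewrite (YT_compat _ e1); try lia.
move: e' h3 h4; rewrite !addnS -!addSn => e' h3 h4.
by apply: IH; lia.
Qed.

Lemma YB_shift r r' s s' e e' c1 c1' c2 c2' :
  r <= r' -> c1 <= c1' <= s ->
  c1 + r = c2 + r' -> c1' + r = c2' + r' ->
  @YB r s e c1 c1' = @YB r' s' e' c2 c2'.
Proof.
move=> h; rewrite -(subnKC h) in e' *; move: (r' - r) e' => k {h r'}.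
elim: k => [|k IH] in r s e c1 c1' c2 c2' *.
  rewrite addn0 => e' h2 h3 h4.
  have ? : s = s' by lia.
  have -> : c1 = c2 by lia.
  have -> : c1' = c2' by lia.
  subst s'; congr YB; exact: Prop_irrelevance.
case: s e => [|s] e e' h2 h3 h4; first lia.
case: c1 c1' h2 h3 h4 => [|c1] [|c1'] h2 h3 h4; try lia.
have e1 : r.+1 + s = n by lia.
rewrite (YB_compat _ e1); try lia.
move: e' h3 h4; rewrite !addnS -!addSn => e' h3 h4.
by apply: IH; lia.
Qed.

(* The images of the arrows (a, b) -> (a', b') of T_n that come from the total
   category of [square r (n - r)] along alpha^r. *)
Definition triW (r : 'I_n.+1) (a a' b b' : nat) : arr (total xi) :=
  YT (subnKC (leq_ord r)) a a' (b - r) (b' - r).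

Definition triO (r : 'I_n.+1) (a b : nat) : obj (total xi) :=
  fobj (ftot (sval y r (n - r) (subnKC (leq_ord r))))
    ((clip r a, clip (n - r) (b - r)) : obj (prodcat (ordcat r) (ordcat (n - r)))).

Lemma dom_W r a a' b b' : a <= a' -> b <= b' -> dom (triW r a a' b b') = triO r a b.
Proof.
move=> h1 h2; rewrite /triW /YT /triO farr_dom; congr fobj.
by congr pair; apply: dom_oarr => //; lia.
Qed.

Lemma cod_W r a a' b b' : cod (triW r a a' b b') = triO r a' b'.
Proof. by rewrite /triW /YT /triO farr_cod. Qed.

Lemma W_id r a b : triW r a a b b = idt (triO r a b).
Proof.
rewrite /triW /YT /triO -farr_idt; congr farr.
by congr pair; apply: oarr_id.
Qed.

Lemma W_shift_le (r r' : 'I_n.+1) a a' b b' : r <= r' ->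
  a <= a' <= r -> r' <= b -> b <= b' <= n -> triW r a a' b b' = triW r' a a' b b'.
Proof. by move=> h1 h2 h3 h4; apply: YT_shift; lia. Qed.

Lemma W_shift (r r' : 'I_n.+1) a a' b b' :
  a <= a' -> a' <= r -> a' <= r' -> r <= b -> r' <= b -> b <= b' <= n ->
  triW r a a' b b' = triW r' a a' b b'.
Proof.
move=> h1 h2 h3 h4 h5 h6; case: (leqP r r') => h.
  by apply: W_shift_le; lia.
by symmetry; apply: W_shift_le; lia.
Qed.

Lemma O_shift (r r' : 'I_n.+1) a b :
  a <= r -> a <= r' -> r <= b -> r' <= b -> b <= n -> triO r a b = triO r' a b.
Proof.
move=> h1 h2 h3 h4 h5; rewrite -(cod_W r a a b b) (@W_shift r r') //; try lia.
by rewrite cod_W.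
Qed.

Lemma W_cmp (r : 'I_n.+1) a a' a'' b b' b'' :
  a <= a' <= a'' -> b <= b' <= b'' ->
  tcmp (triW r a' a'' b' b'') (triW r a a' b b') = triW r a a'' b b''.
Proof.
move=> h1 h2; rewrite /triW /YT -farr_tcmp; last first.
  by congr pair; rewrite dom_oarr //; lia.
congr farr.
have ec : cod ((oarr r a a', oarr (n - r) (b - r) (b' - r)) :
                arr (prodcat (ordcat r) (ordcat (n - r)))) =
          dom ((oarr r a' a'', oarr (n - r) (b' - r) (b'' - r)) :
                arr (prodcat (ordcat r) (ordcat (n - r)))).
  by congr pair; rewrite dom_oarr //; lia.
rewrite -(tcmpE ec); congr pair; rewrite tcmpE oarr_cmp //; lia.
Qed.

Lemma proj_W (r : 'I_n.+1) a a' b b' : r <= b <= b' -> b' <= n ->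
  farr (proj xi) (triW r a a' b b') = YB (erefl : 0 + n = n) b b'.
Proof.
move=> h1 h2.
have := fsquare (sval y r (n - r) (subnKC (leq_ord r))).
move=> /(congr1 (fun F : functor (prodcat (ordcat r) (ordcat (n - r))) (base xi)
  => farr F ((oarr r a a', oarr (n - r) (b - r) (b' - r)) :
                arr (prodcat (ordcat r) (ordcat (n - r)))))) H.
apply: etrans H _; symmetry; apply: YB_shift; lia.
Qed.

Definition fsto (x : obj (tricat n)) : 'I_n.+1 := (sval x).1.
Definition sndo (x : obj (tricat n)) : 'I_n.+1 := (sval x).2.

Lemma tri_obj_le x : fsto x <= sndo x.
Proof. exact: (svalP x). Qed.
Lemma tri_fst_le (f : arr (tricat n)) : fsto (dom f) <= fsto (cod f).
Proof. exact: (ordarr_le (sval f).1). Qed.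
Lemma tri_snd_le (f : arr (tricat n)) : sndo (dom f) <= sndo (cod f).
Proof. exact: (ordarr_le (sval f).2). Qed.

(* An arrow (a, b) -> (a', b') of T_n factors through (a, b'). *)
Definition glue_obj (x : obj (tricat n)) : obj (total xi) :=
  triO (fsto x) (fsto x) (sndo x).

Definition glue_v (f : arr (tricat n)) : arr (total xi) :=
  triW (fsto (cod f)) (fsto (dom f)) (fsto (cod f)) (sndo (cod f)) (sndo (cod f)).

Definition glue_h (f : arr (tricat n)) : arr (total xi) :=
  triW (fsto (dom f)) (fsto (dom f)) (fsto (dom f)) (sndo (dom f)) (sndo (cod f)).

Ltac trilia f := have := (tri_fst_le f); have := (tri_snd_le f);
  have := (tri_obj_le (dom f)); have := (tri_obj_le (cod f));
  have := (leq_ord (sndo (cod f))); have := leq_ord (fsto (cod f)).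

Lemma glue_composable f : cod (glue_h f) = dom (glue_v f).
Proof.
rewrite /glue_h /glue_v cod_W dom_W //; last exact: tri_fst_le.
by trilia f; move=> *; apply: O_shift; lia.
Qed.

Definition glue_arr (f : arr (tricat n)) : arr (total xi) :=
  cmp (glue_v f) (glue_h f) (glue_composable f).

Lemma glue_arrE f : glue_arr f = tcmp (glue_v f) (glue_h f).
Proof. exact: tcmpE. Qed.

Lemma glue_dom f : dom (glue_arr f) = glue_obj (dom f).
Proof. by rewrite dom_cmp dom_W //; exact: tri_snd_le. Qed.

Lemma glue_cod f : cod (glue_arr f) = glue_obj (cod f).
Proof. by rewrite cod_cmp cod_W. Qed.

Lemma glue_idt x : glue_arr (idt x) = idt (glue_obj x).
Proof.
rewrite glue_arrE /glue_v /glue_h dom_idt cod_idt !W_id tcmp_idl //.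
exact: cod_idt.
Qed.

Lemma glue_cmp g f (e : cod f = dom g) e' :
  glue_arr (cmp g f e) = cmp (glue_arr g) (glue_arr f) e'.
Proof.
rewrite [RHS]tcmpE !glue_arrE /glue_v /glue_h dom_cmp cod_cmp -e.
have := (tri_snd_le g); have := (tri_fst_le g); rewrite -e => g1 g2.
have gc := tri_obj_le (cod g); have gn := leq_ord (sndo (cod g)).
have fc := tri_obj_le (cod f); have fd := tri_obj_le (dom f).
have f1 := tri_fst_le f; have f2 := tri_snd_le f.
move: (fsto (dom f)) (fsto (cod f)) (fsto (cod g)) (sndo (dom f)) (sndo (cod f))
  (sndo (cod g)) g1 g2 gc gn fc fd f1 f2 => a a' a'' b b' b'' *.
have E1 : tcmp (triW a' a' a' b' b'') (triW a' a a' b' b') =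
          tcmp (triW a'' a a' b'' b'') (triW a a a b' b'').
  rewrite W_cmp; try lia.
  rewrite (@W_shift a'' a'); try lia.
  rewrite (@W_shift a a'); try lia.
  by rewrite W_cmp //; lia.
have dW r p p' q q' : p <= p' -> q <= q' -> dom (triW r p p' q q') = triO r p q.
  exact: dom_W.
have oS (r r' : 'I_n.+1) p q :
  p <= r -> p <= r' -> r <= q -> r' <= q -> q <= n -> triO r p q = triO r' p q.
  exact: O_shift.
have C (r r' : 'I_n.+1) (p q : nat) : p <= r -> p <= r' -> r <= q -> r' <= q -> q <= n ->
    forall q0 p0 p1 q1, q0 <= q -> p0 <= p -> p <= p1 -> q <= q1 ->
    cod (triW r p0 p q0 q) = dom (triW r' p p1 q q1).
  by move=> *; rewrite cod_W dW //; apply: oS.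
rewrite -(tcmpA (h := triW a'' a' a'' b'' b'')); first last.
- by rewrite ?cod_tcmp; apply: C; lia.
- by rewrite ?cod_tcmp; apply: C; lia.
rewrite (tcmpA (g := triW a' a a' b' b')); first last.
- by rewrite ?cod_tcmp; apply: C; lia.
- by rewrite ?cod_tcmp; apply: C; lia.
rewrite E1 -(tcmpA (h := triW a'' a a' b'' b'')); first last.
- by rewrite ?cod_tcmp; apply: C; lia.
- by rewrite ?cod_tcmp; apply: C; lia.
rewrite (W_cmp a) ?(tcmpA (h := triW a'' a' a'' b'' b'')); try lia; first last.
- by rewrite ?cod_tcmp; apply: C; lia.
- by rewrite ?cod_tcmp; apply: C; lia.
by rewrite (W_cmp a'' (a' := a')) //; lia.
Qed.

Definition glue_functor : functor (tricat n) (total xi) :=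
  Functor glue_dom glue_cod glue_idt glue_cmp.

Definition glue_base : functor (ordcat n) (base xi) :=
  fbase (sval y 0 n erefl).

Lemma proj_idt_W (r : 'I_n.+1) a a' b : a <= a' -> r <= b -> b <= n ->
  farr (proj xi) (triW r a a' b b) = idt (fobj (proj xi) (triO r a b)).
Proof.
move=> h0 h1 h2; rewrite proj_W ?leqnn ?h1 //.
rewrite -(dom_W r h0 (leqnn b)) -farr_dom proj_W ?leqnn ?h1 //.
by rewrite /YB oarr_id farr_idt dom_idt.
Qed.

Lemma glue_square : fcomp (proj xi) glue_functor = fcomp glue_base (proj (tri n)).
Proof.
apply: functor_eq => f; rewrite [LHS]/= glue_arrE.
rewrite farr_tcmp; last exact: glue_composable.
trilia f => *.
rewrite /glue_v proj_idt_W; try lia.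
rewrite tcmp_idl.
  rewrite /glue_h proj_W //; last lia.
  rewrite /YB [in RHS]/= [(sval f).2 in RHS]oarr_ord //.
rewrite farr_cod cod_W; congr fobj; apply: O_shift; lia.
Qed.

Lemma glue_cart f : cartesian (proj (tri n)) f ->
  cartesian (proj xi) (farr glue_functor f).
Proof.
move=> /(proj1 (tri_coord n)) hf.
have {hf} e : fsto (cod f) = fsto (dom f).
  have := congr1 (@cod _) hf; rewrite cod_idt => H; exact: H.
rewrite [farr _ _]/= glue_arrE /glue_v /glue_h e W_id tcmp_idl ?cod_W //.
apply: fcart; apply/(proj1 (square_coord _ _)).
exact: is_idt_oarr.
Qed.

Definition glue : fibmap (tri n) xi :=
  @FibMap (tri n) xi glue_functor glue_base glue_square glue_cart.

End Glue.

Lemma ltnS_add r s n : r + s = n -> r < n.+1.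
Proof. by move<-; rewrite ltnS leq_addr. Qed.

Lemma glueK (xi : fibration) n (y : codiag (fnerve xi) n) :
  tri_codiag (glue y) = y.
Proof.
apply: codiag_eq => r s e /=; apply: fibmap_eq; apply: functor_eq; last first.
  move=> f; rewrite [in RHS](oarr_ord f).
  have := ordarr_le f.
  set c : nat := dom f; set c' : nat := cod f => h.
  have hc' : c' <= s := leq_ord (cod f : 'I_s.+1).
  rewrite -[RHS]/(YB y e c c').
  rewrite -(@YB_shift xi n y 0 r n s erefl e (c + r) (c' + r)) //; try lia.
  rewrite /= /glue_base /YB; congr farr.
  rewrite [in LHS](oarr_ord f) -[LHS]/(farr (ordF (alpha_snd e)) (oarr s c c')).
  apply: ordF_oarr; rewrite -/c -/c' /= ?clipE; lia.
move=> t; have hr : r < n.+1 by exact: ltnS_add e.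
set rr := Ordinal hr.
case: t => f g; rewrite [LHS]/= glue_arrE.
rewrite [in RHS](oarr_ord f) [in RHS](oarr_ord g).
have := ordarr_le g; have := ordarr_le f.
rewrite -[RHS]/(YT y e (dom f : 'I_r.+1) (cod f : 'I_r.+1)
                       (dom g : 'I_s.+1) (cod g : 'I_s.+1)).
rewrite /glue_v /glue_h /fsto /sndo /=.
set a := (sval f).1; set a' := (sval f).2; set c := (sval g).1; set c' := (sval g).2.
move=> h1 h2; have ha' : a' <= r := leq_ord a'; have hc' : c' <= s := leq_ord c'.
rewrite (@W_shift _ _ y _ rr) /=; try lia.
rewrite (@W_shift _ _ y (Ordinal (alpha_fst_proof e a)) rr) /=; try lia.
rewrite W_cmp; try lia.
by apply: YT_shift => /=; lia.
Qed.

Lemma tri_obj_ext n (x z : obj (tricat n)) :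
  fsto x = fsto z :> nat -> sndo x = sndo z :> nat -> x = z.
Proof.
case: x z => [[a b] h] [[c d] k] e1 e2; apply: sub_eq.
have e1' : a = c := val_inj e1; have e2' : b = d := val_inj e2.
by rewrite /= e1' e2'.
Qed.

Lemma tri_arr_ext n (f g : arr (tricat n)) :
  dom f = dom g -> cod f = cod g -> f = g.
Proof.
move=> e1 e2; apply: tri_arr_eq; apply: ordarr_eq; rewrite !(farr_dom, farr_cod);
  by rewrite ?e1 ?e2.
Qed.

Definition WA n (r : 'I_n.+1) (a a' b b' : nat) : arr (tricat n) :=
  farr (ftot (alpha (subnKC (leq_ord r))))
    ((oarr r a a', oarr (n - r) (b - r) (b' - r)) :
       arr (prodcat (ordcat r) (ordcat (n - r)))).

Lemma WA_coords n (r : 'I_n.+1) a a' b b' :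
  a <= a' <= r -> r <= b -> b <= b' <= n ->
  [/\ fsto (dom (WA r a a' b b')) = a :> nat,
      sndo (dom (WA r a a' b b')) = b :> nat,
      fsto (cod (WA r a a' b b')) = a' :> nat &
      sndo (cod (WA r a a' b b')) = b' :> nat].
Proof. by move=> h1 h2 h3; split; rewrite /= clipE; lia. Qed.

Lemma tri_codiagK (xi : fibration) n (x : fibmap (tri n) xi) :
  glue (tri_codiag x) = x.
Proof.
apply: fibmap_eq; apply: functor_eq; last first.
  move=> f /=; congr farr; apply: ordarr_eq; apply: val_inj; exact: addn0.
move=> t; rewrite [LHS]/= glue_arrE.
have t1 := tri_fst_le t; have t2 := tri_snd_le t.
have t3 := tri_obj_le (dom t); have t4 := tri_obj_le (cod t).
have t5 := leq_ord (sndo (cod t)).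
set V := WA (fsto (cod t)) (fsto (dom t)) (fsto (cod t)) (sndo (cod t)) (sndo (cod t)).
set H := WA (fsto (dom t)) (fsto (dom t)) (fsto (dom t)) (sndo (dom t)) (sndo (cod t)).
rewrite -[glue_v _ _]/(farr (ftot x) V) -[glue_h _ _]/(farr (ftot x) H).
have [V1 V2 V3 V4] : [/\ fsto (dom V) = fsto (dom t) :> nat,
    sndo (dom V) = sndo (cod t) :> nat, fsto (cod V) = fsto (cod t) :> nat &
    sndo (cod V) = sndo (cod t) :> nat].
  by apply: WA_coords; rewrite ?leqnn ?t1 ?t4 ?t5.
have [H1 H2 H3 H4] : [/\ fsto (dom H) = fsto (dom t) :> nat,
    sndo (dom H) = sndo (dom t) :> nat, fsto (cod H) = fsto (dom t) :> nat &
    sndo (cod H) = sndo (cod t) :> nat].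
  by apply: WA_coords; rewrite ?leqnn ?t2 ?t3 ?t5.
have e : cod H = dom V by apply: tri_obj_ext; rewrite ?H3 ?H4 ?V1 ?V2.
rewrite -farr_tcmp //; congr farr.
rewrite -(tcmpE e); apply: tri_arr_ext; rewrite ?dom_cmp ?cod_cmp;
  by apply: tri_obj_ext; rewrite ?H1 ?H2 ?V3 ?V4.
Qed.

Lemma tri_diag_proof n x :
  tri_pred (fobj (fpair (fid (ordcat n)) (fid (ordcat n))) x).
Proof. exact: leqnn. Qed.

Definition tri_diag n : functor (ordcat n) (tricat n) :=
  corestrict (@tri_diag_proof n).

(* [glue] is the inverse of the isomorphism [tri_codiag], see [glueK] and
   [tri_codiagK]. *)
Definition kbar (xi : fibration) n (y : codiag (fnerve xi) n) :
    nerve (total xi) n :=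
  fcomp (ftot (glue y)) (tri_diag n).

Lemma kbar_tri_codiag (xi : fibration) n (x : fibmap (tri n) xi) :
  kbar (tri_codiag x) = fcomp (ftot x) (tri_diag n).
Proof. by rewrite /kbar tri_codiagK. Qed.

(* Main.v *)
From mathcomp Require Import all_boot boolp zify.
Require Import Defs.

Set Implicit Arguments.
Unset Strict Implicit.
Unset Printing Implicit Defensive.

(** An n-simplex of the codiagonal of the fibred nerve is the same thing as a
    fibred map out of T_n ([glueK], [tri_codiagK]); it comes from the cleaved
    nerve exactly when the map sends the horizontal arrows (a, b) -> (a, b') of
    T_n into the cleavage ([glue_cleaved], [tri_cleaved_codiag]). Through this
    dictionary the theorem says that every functor z : [n] -> E is the
    restriction to the diagonal of exactly one such map.

    Such a map x is determined by z = x diag. Its value on (a, a) -> (a, b) has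
    to be the lift s(a, b) in the cleavage, with domain z(a), of the image of
    a <= b under p z. The value h on an arrow (a, b) -> (a', b') lies over
    p z (b <= b') and satisfies h s(a, b) = s(a', b') z(a <= a'). In a fibration
    a cartesian arrow also has the universal property over arrows of the base
    that are not identities ([cartesian_fill]), so these two conditions
    determine h ([tri_cleaved_inj]).

    Conversely, the same two conditions define a functor on T_n, and uniqueness
    gives functoriality. It restricts to z on the diagonal because the cleavage
    is normal ([ext_unit_diag]), and it sends horizontal arrows into the
    cleavage because the cleavage is closed: lifting b <= b' at the codomain of
    s(a, b) and composing with s(a, b) gives a member of the cleavage, which can
    only be s(a, b') ([ext_horizontal]).

    The map is simplicial because T_n and its diagonal are functorial in n and
    the operators of the codiagonal are the restrictions along the maps
    T_m -> T_n ([tri_codiag_face], [tri_codiag_degen]). *)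

(** * Isomorphisms of simplicial sets *)

Lemma bijective_sset_iso (X Y : sset) (f : forall n, X n -> Y n) :
  is_sset_map f -> (forall n, injective (f n)) ->
  (forall n y, exists x, f n x = y) -> is_sset_iso f.
Proof.
move=> hf finj fsurj; split=> //.
pose g n y : X n := sval (cid (fsurj n y)).
have fg n : cancel (g n) (f n) by move=> y; exact: svalP (cid (fsurj n y)).
have gf n : cancel (f n) (g n) by move=> x; apply: finj; rewrite fg.
exists g; split=> //; case: hf => hd hs.
by split=> n i y; apply: finj; rewrite fg (hd, hs) fg.
Qed.

Lemma codiag_map_sset_map (K L : bisset) (f : bisset_map K L) :
  is_sset_map (X := codiag K) (Y := codiag L) (codiag_map f).
Proof.
split=> n i [x hx]; apply: codiag_eq => a b e /=.
  by rewrite /codiag_face_fam; case: ifP => _; rewrite (bimap_faceh, bimap_facev).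
case: a b e => [|a] [|b] e //=; rewrite ?bimap_degenh ?bimap_degenv //.
by case: ifP => _; rewrite (bimap_degenh, bimap_degenv).
Qed.

(** * Functoriality of T_n and the operators of the codiagonal *)

Lemma tri_map_proof m n (u : mono m n) (x : obj (tricat m)) :
  tri_pred (fobj (fcomp (fprod (ordF u) (ordF u)) (incl (@tri_pred m))) x).
Proof. exact: mfunP (tri_obj_le x). Qed.

Definition tri_map m n (u : mono m n) : fibmap (tri m) (tri n).
Proof.
refine (@FibMap (tri m) (tri n) (corestrict (tri_map_proof u)) (ordF u) _ _).
- abstract (by apply: functor_eq).
- abstract (move=> f /(proj1 (tri_coord m)) hf; apply/(proj1 (tri_coord n));
    exact: (is_idt_farr (ordF u) hf)).
Defined.

(** The shape shared by all components of the operators of the codiagonal: a map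
    T_m -> T_n carries a square alpha^r into a square alpha^r'. *)
Lemma tri_map_alpha m n r s r' s' (e : r + s = m) (e' : r' + s' = n)
    (u : mono m n) (v : mono r r') (w : mono s s') :
  (forall a, u (alpha_fst e a) = v a :> nat) ->
  (forall b, u (alpha_snd e b) = w b + r' :> nat) ->
  fmcomp (tri_map u) (alpha e) = fmcomp (alpha e') (square_map v w).
Proof.
move=> hv hw; apply: fibmap_eq; apply: functor_eq.
  case=> f g; apply: tri_arr_eq; apply: ordarr_eq; apply: val_inj;
    [exact: hv|exact: hv|exact: hw|exact: hw].
by move=> f; apply: ordarr_eq; apply: val_inj; exact: hw.
Qed.

Lemma coface_nat n (i : 'I_n.+2) x :
  coface i x = (if i <= x then x.+1 else x) :> nat.
Proof. by rewrite /= /bump; case: (i <= x). Qed.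

(** The codiagonal uses d^h_(i-a) on the component a when a < i because the
    first coordinate then stays below i and only the second, shifted by a, sees
    the coface; otherwise the second coordinate goes from b + a to b + (a + 1),
    so that alpha^a lands in the square alpha^(a+1) and only the first sees the
    coface. *)
Lemma tri_codiag_face (xi : fibration) n (i : 'I_n.+2) (x : fibmap (tri n.+1) xi) :
  tri_codiag (fmcomp x (tri_map (coface i))) =
  face (codiag (fnerve xi)) i (tri_codiag x).
Proof.
apply: codiag_eq => a b e /=; rewrite -fmcompA /codiag_face_fam.
have hi := ltn_ord i.
case: ifP => h; rewrite [RHS]/= -fmcompA; congr fmcomp; apply: tri_map_alpha => k;
  have := ltn_ord k; rewrite coface_nat ?coface_val //=; do ?case: ifP; lia.
Qed.

Lemma tri_codiag_degen (xi : fibration) n (j : 'I_n.+1) (x : fibmap (tri n) xi) :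
  tri_codiag (fmcomp x (tri_map (codegen j))) =
  degen (codiag (fnerve xi)) j (tri_codiag x).
Proof.
apply: codiag_eq => a b e /=; rewrite -fmcompA; have hj := ltn_ord j.
case: (leqP a j) => h.
  case: b e => [|b] e; first lia.
  have e' : a + b = n by lia.
  rewrite (codiag_degen_le _ e e') //= -fmcompA; congr fmcomp.
  apply: tri_map_alpha => k; have := ltn_ord k.
    by rewrite codegen_funE /=; case: ifP; lia.
  by rewrite codegen_funE codegen_val /=; do ?case: ifP; lia.
case: a e h => [|a] e h; first lia.
have e' : a + b = n by lia.
rewrite (codiag_degen_gt _ e e') //= -fmcompA; congr fmcomp.
apply: tri_map_alpha => k; have := ltn_ord k.
  by rewrite codegen_funE codegen_val /=; do ?case: ifP; lia.
by rewrite codegen_funE /=; case: ifP; lia.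
Qed.

Lemma tri_map_diag m n (u : mono m n) :
  fcomp (ftot (tri_map u)) (tri_diag m) = fcomp (tri_diag n) (ordF u).
Proof. by apply: functor_eq => f; apply: sub_eq. Qed.

(** By [glueK] every simplex of the codiagonal is a fibred map out of T_n, on
    which both the operators and the restriction to the diagonal are
    precompositions. *)
Lemma kbar_sset_map (xi : fibration) :
  is_sset_map (X := codiag (fnerve xi)) (Y := nerve (total xi)) (@kbar xi).
Proof.
split=> n i y; rewrite -(glueK y).
  rewrite -tri_codiag_face !kbar_tri_codiag /=.
  by rewrite -!fcompA -tri_map_diag.
rewrite -tri_codiag_degen !kbar_tri_codiag /=.
by rewrite -!fcompA -tri_map_diag.
Qed.

(** * Cartesian arrows in a fibration *)

Lemma cartesian_tcmp (E B : category) (p : functor E B) (f g : arr E) :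
  cartesian p f -> dom g = dom f -> farr p g = farr p f ->
  exists! h, [/\ dom h = cod f, farr p h = idt (fobj p (cod f)) & tcmp h f = g].
Proof.
move=> hf dg pg; have [h [[ph [e hh]] hu]] := hf g dg pg.
exists h; split; first by rewrite -tcmpE.
move=> h' [dh' ph' hh']; apply: hu; split=> //.
by exists (esym dh'); rewrite tcmpE.
Qed.

(** Closure of cartesian arrows under composition upgrades the universal property
    from vertical arrows to arrows over any psi: take a cartesian lift k of psi
    at the codomain of f; then h must be v k, with v the vertical arrow given by
    the cartesian arrow k f. *)
Lemma cartesian_fill (xi : fibration) (f g : arr (total xi)) (psi : arr (base xi)) :
  cartesian (proj xi) f -> dom g = dom f ->
  cod (farr (proj xi) f) = dom psi ->
  farr (proj xi) g = tcmp psi (farr (proj xi) f) ->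
  exists! h, [/\ dom h = cod f, farr (proj xi) h = psi & tcmp h f = g].
Proof.
have [pre closed] := fibrationP xi.
move=> hf dg dpsi pg.
have [k [ck dk pk]] : exists k, [/\ cartesian (proj xi) k, dom k = cod f
    & farr (proj xi) k = psi].
  by apply: pre; rewrite -dpsi farr_cod.
have ckf : cartesian (proj xi) (tcmp k f).
  by rewrite -(tcmpE (esym dk)); exact: closed.
have [||v [[dv pv hv] vuniq]] := cartesian_tcmp (g := g) ckf.
- by rewrite dom_tcmp.
- by rewrite farr_tcmp // pk.
rewrite cod_tcmp // in dv pv vuniq.
exists (tcmp v k); split.
  split; rewrite -?tcmpA ?dom_tcmp // farr_tcmp // pv tcmp_idl ?pk //.
  by rewrite -pk farr_cod.
move=> h [dh ph hh].
have [||v' [[dv' pv' hv'] _]] := cartesian_tcmp (g := h) ck.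
- by rewrite dh.
- by rewrite ph.
by rewrite -hv' (vuniq v') //; split=> //; rewrite tcmpA // hv'.
Qed.

(** * Cleaved simplices as maps out of T_n *)

Definition tri_horizontal n (f : arr (tricat n)) : Prop := is_idt (farr (tri_fst n) f).

Lemma tri_horizontal_fst n (f : arr (tricat n)) :
  tri_horizontal f -> fsto (cod f) = fsto (dom f).
Proof. by move=> hf; have := congr1 (@cod _) hf; rewrite cod_idt => H; exact: H. Qed.

Definition tri_cleaved (xi : fibration) (Sigma : cleavage xi) n (x : fibmap (tri n) xi) :=
  forall f, tri_horizontal f -> Sigma (farr (ftot x) f).

Lemma glue_cleaved (xi : fibration) (Sigma : cleavage xi) n
    (y : codiag (cnerve Sigma) n) :
  tri_cleaved Sigma (glue (codiag_map (cnerve_incl Sigma) y)).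
Proof.
move=> f hf; have e := tri_horizontal_fst hf.
rewrite [farr _ _]/= glue_arrE /glue_v /glue_h e W_id tcmp_idl ?cod_W //.
by apply: (svalP (sval y _ _ _)); exact: is_idt_oarr.
Qed.

Lemma cleaved_alpha (xi : fibration) (Sigma : cleavage xi) n (x : fibmap (tri n) xi)
    (hx : tri_cleaved Sigma x) r s (e : r + s = n) :
  is_cleaved (square_cleavage r s) Sigma (fmcomp x (alpha e)).
Proof.
by move=> f hf; apply: hx; exact: (is_idt_farr (ordF (alpha_fst e)) hf).
Qed.

(** Being cleaved on T_n restricts along every alpha^r, and compatibility of the
    components is inherited from the fibred nerve. *)
Lemma tri_cleaved_codiag (xi : fibration) (Sigma : cleavage xi) n
    (x : fibmap (tri n) xi) : tri_cleaved Sigma x ->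
  exists y, codiag_map (cnerve_incl Sigma) y = tri_codiag x :> codiag (fnerve xi) n.
Proof.
move=> hx.
pose y : codiag_fam (cnerve Sigma) n :=
  fun r s e => exist _ _ (cleaved_alpha hx e).
have hy : codiag_compat y.
  by move=> a b e e'; apply: sub_eq; exact: (tri_codiag_compat x e e').
by exists (exist _ y hy); apply: codiag_eq.
Qed.

Lemma codiag_incl_inj (xi : fibration) (Sigma : cleavage xi) n :
  injective (@codiag_map _ _ (cnerve_incl Sigma) n).
Proof.
move=> y y' h; apply: codiag_eq => a b e; apply: sub_eq.
exact: (congr1 (fun t : codiag (fnerve xi) n => sval t a b e) h).
Qed.

(** * Restriction to the diagonal is injective on cleaved maps *)

Section TriArrows.
Variable n : nat.

Definition ord_arrow (a b : 'I_n.+1) (h : a <= b) : arr (ordcat n) := exist _ (a, b) h.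

(** The underlying pair of the horizontal arrow (a, a) -> (a, b) for x = (a, b). *)
Definition tri_unit_pair (x : obj (tricat n)) : arr (prodcat (ordcat n) (ordcat n)) :=
  (idt (fsto x : obj (ordcat n)), ord_arrow (tri_obj_le x)).

Lemma tri_unit_proof x :
  tri_pred (dom (tri_unit_pair x)) && tri_pred (cod (tri_unit_pair x)).
Proof. by rewrite /tri_pred /= leqnn tri_obj_le. Qed.

Definition tri_unit (x : obj (tricat n)) : arr (tricat n) :=
  exist _ (tri_unit_pair x) (tri_unit_proof x).

Lemma dom_tri_unit x : dom (tri_unit x) = fobj (tri_diag n) (fsto x).
Proof. exact: tri_obj_ext. Qed.

Lemma cod_tri_unit x : cod (tri_unit x) = x.
Proof. exact: tri_obj_ext. Qed.

(** (a, b) |-> (a, a) is a coreflection of T_n onto its diagonal, with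
    [tri_unit] as counit. *)
Lemma tri_unit_natural (f : arr (tricat n)) :
  tcmp f (tri_unit (dom f)) =
  tcmp (tri_unit (cod f)) (farr (tri_diag n) (farr (tri_fst n) f)).
Proof.
have e1 := cod_tri_unit (dom f).
have e2 : cod (farr (tri_diag n) (farr (tri_fst n) f)) = dom (tri_unit (cod f)).
  by rewrite farr_cod dom_tri_unit.
apply: tri_arr_ext; rewrite ?dom_tcmp ?cod_tcmp //.
  by rewrite dom_tri_unit farr_dom.
by rewrite cod_tri_unit.
Qed.

Lemma tri_horizontal_unit x : tri_horizontal (tri_unit x).
Proof. by []. Qed.

End TriArrows.

(** The projection of T_n restricts to the identity on the diagonal. *)
Lemma fbase_diag (xi : fibration) n (x : fibmap (tri n) xi) :
  fbase x = fcomp (proj xi) (fcomp (ftot x) (tri_diag n)).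
Proof.
rewrite fcompA fsquare; apply: functor_eq => f /=; congr farr; exact: ordarr_eq.
Qed.

(** On [tri_unit] both maps give the unique lift in the cleavage with prescribed
    domain and image; on the other arrows naturality of [tri_unit] and
    [cartesian_fill] leave a single choice. *)
Lemma tri_cleaved_inj (xi : fibration) (Sigma : cleavage xi) n
    (x x' : fibmap (tri n) xi) :
  tri_cleaved Sigma x -> tri_cleaved Sigma x' ->
  fcomp (ftot x) (tri_diag n) = fcomp (ftot x') (tri_diag n) -> x = x'.
Proof.
move=> hx hx' ed.
have eb : fbase x = fbase x' by rewrite !fbase_diag ed.
have pE (z : fibmap (tri n) xi) f :
    farr (proj xi) (farr (ftot z) f) = farr (fbase z) (farr (tri_proj n) f).
  exact: (congr1 (fun F : functor _ _ => farr F f) (fsquare z)).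
have eu t : farr (ftot x) (tri_unit t) = farr (ftot x') (tri_unit t).
  have hd : dom (farr (proj xi) (farr (ftot x) (tri_unit t))) =
            fobj (proj xi) (dom (farr (ftot x) (tri_unit t))).
    exact: farr_dom.
  have [s [_ su]] := cl_lift Sigma hd.
  rewrite -(su _ (And3 (hx _ (tri_horizontal_unit t)) erefl erefl)).
  rewrite -(su _ (And3 (hx' _ (tri_horizontal_unit t)) _ _)) //; last first.
    by rewrite !pE eb.
  rewrite !farr_dom dom_tri_unit.
  exact: (congr1 (fun F : functor (ordcat n) (total xi) => fobj F (fsto t)) (esym ed)).
apply: fibmap_eq => //; apply: functor_eq => f.
have comp (z : fibmap (tri n) xi) : tcmp (farr (ftot z) f) (farr (ftot z) (tri_unit (dom f)))
    = tcmp (farr (ftot z) (tri_unit (cod f)))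
           (farr (fcomp (ftot z) (tri_diag n)) (farr (tri_fst n) f)).
  rewrite -farr_tcmp ?cod_tri_unit // tri_unit_natural farr_tcmp //.
  by rewrite farr_cod dom_tri_unit.
have domE (z : fibmap (tri n) xi) :
    dom (farr (ftot z) f) = cod (farr (ftot z) (tri_unit (dom f))).
  by rewrite farr_dom farr_cod cod_tri_unit.
have hg : dom (tcmp (farr (ftot x) f) (farr (ftot x) (tri_unit (dom f)))) =
          dom (farr (ftot x) (tri_unit (dom f))) by rewrite dom_tcmp.
have [h [_ hu]] := cartesian_fill (cl_cart (hx _ (tri_horizontal_unit (dom f)))) hg
  (farr_composable (proj xi) (esym (domE x)))
  (farr_tcmp (proj xi) (esym (domE x))).
rewrite -(hu (farr (ftot x) f) (And3 (domE x) erefl erefl)).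
apply: hu; split; first by rewrite domE eu.
  by rewrite !pE eb.
by rewrite [RHS]comp ed (eu (cod f)) -comp eu.
Qed.

(** * Extension of a simplex of the nerve along the diagonal *)

Section Extend.
Variables (xi : fibration) (Sigma : cleavage xi) (Sigma_closed : closed_cleavage Sigma).
Variables (n : nat) (z : functor (ordcat n) (total xi)).
Local Notation p := (proj xi).

Lemma ext_unit_ex (t : obj (tricat n)) :
  exists s, [/\ Sigma s, dom s = fobj z (fsto t)
              & farr p s = farr p (farr z (ord_arrow (tri_obj_le t)))].
Proof.
have [|s [hs _]] := cl_lift Sigma (e := fobj z (fsto t))
    (phi := farr p (farr z (ord_arrow (tri_obj_le t)))); first by rewrite !farr_dom.
by exists s.
Qed.

(** For t = (a, b), the lift s(a, b) with domain z(a) over p z (a <= b). *)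
Definition ext_unit t : arr (total xi) := sval (cid (ext_unit_ex t)).

Lemma ext_unitP t : [/\ Sigma (ext_unit t), dom (ext_unit t) = fobj z (fsto t)
  & farr p (ext_unit t) = farr p (farr z (ord_arrow (tri_obj_le t)))].
Proof. exact: svalP (cid (ext_unit_ex t)). Qed.

Lemma dom_ext_unit t : dom (ext_unit t) = fobj z (fsto t).
Proof. by case: (ext_unitP t). Qed.

(** What a cleaved map extending z has to satisfy on f, by [tri_unit_natural]. *)
Definition ext_spec (f : arr (tricat n)) (h : arr (total xi)) : Prop :=
  [/\ dom h = cod (ext_unit (dom f)),
      farr p h = farr p (farr z (farr (tri_proj n) f))
    & tcmp h (ext_unit (dom f)) =
      tcmp (ext_unit (cod f)) (farr z (farr (tri_fst n) f))].

Lemma ext_composable f :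
  cod (farr z (farr (tri_fst n) f)) = dom (ext_unit (cod f)).
Proof. by rewrite farr_cod dom_ext_unit. Qed.

Lemma ext_arr_ex f : exists! h, ext_spec f h.
Proof.
have [S1 S2 S3] := ext_unitP (dom f); have [T1 T2 T3] := ext_unitP (cod f).
apply: cartesian_fill; first exact: cl_cart S1.
- by rewrite dom_tcmp ?ext_composable // S2 farr_dom.
- by rewrite S3 !(farr_cod, farr_dom).
rewrite farr_tcmp ?ext_composable // S3 T3.
have c1 : cod (farr (tri_fst n) f) = dom (ord_arrow (tri_obj_le (cod f))) by [].
have c2 : cod (ord_arrow (tri_obj_le (dom f))) = dom (farr (tri_proj n) f) by [].
rewrite -!farr_tcmp //; try exact: farr_composable.
congr (farr p (farr z _)); apply: ordarr_eq; by rewrite ?dom_tcmp ?cod_tcmp.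
Qed.

Definition ext_arr f : arr (total xi) := sval (cid (ext_arr_ex f)).

Lemma ext_arrP f : ext_spec f (ext_arr f).
Proof. by case: (svalP (cid (ext_arr_ex f))). Qed.

Lemma ext_arr_uniq f h : ext_spec f h -> ext_arr f = h.
Proof. by case: (svalP (cid (ext_arr_ex f))) => _; apply. Qed.

Definition ext_obj t : obj (total xi) := cod (ext_unit t).

Lemma ext_dom f : dom (ext_arr f) = ext_obj (dom f).
Proof. by case: (ext_arrP f). Qed.

Lemma ext_cod f : cod (ext_arr f) = ext_obj (cod f).
Proof.
have [h1 h2 h3] := ext_arrP f.
have := congr1 (@cod _) h3; rewrite cod_tcmp // cod_tcmp //.
exact: ext_composable.
Qed.

Lemma ext_proj_obj t : fobj p (ext_obj t) = fobj p (fobj z (sndo t)).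
Proof.
rewrite /ext_obj -farr_cod; have [_ _ ->] := ext_unitP t.
by rewrite !farr_cod.
Qed.

Lemma ext_idt t : ext_arr (idt t) = idt (ext_obj t).
Proof.
apply: ext_arr_uniq; split; rewrite ?dom_idt ?cod_idt //.
  by rewrite farr_idt ext_proj_obj !farr_idt.
by rewrite tcmp_idl // !farr_idt tcmp_idr // dom_ext_unit.
Qed.

Lemma ext_cmp g f (e : cod f = dom g) e' :
  ext_arr (cmp g f e) = cmp (ext_arr g) (ext_arr f) e'.
Proof.
have [F1 F2 F3] := ext_arrP f; have [G1 G2 G3] := ext_arrP g.
rewrite [RHS]tcmpE; apply: ext_arr_uniq; split.
- by rewrite dom_tcmp // F1 dom_cmp.
- rewrite farr_tcmp // F2 G2 tcmpE !farr_tcmp //; by do ?apply: farr_composable.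
have zc : cod (farr z (farr (tri_fst n) f)) = dom (farr z (farr (tri_fst n) g)).
  by do 2!apply: farr_composable.
rewrite dom_cmp cod_cmp -tcmpA // F3 e tcmpA //; last by rewrite -e ext_composable.
rewrite G3 -tcmpA -?ext_composable //.
by rewrite tcmpE !farr_tcmp //; apply: farr_composable.
Qed.

Definition ext_functor : functor (tricat n) (total xi) :=
  Functor ext_dom ext_cod ext_idt ext_cmp.

Lemma ext_square : fcomp p ext_functor = fcomp (fcomp p z) (proj (tri n)).
Proof. by apply: functor_eq => f; have [_ h _] := ext_arrP f. Qed.

(** The lift k of p z (b <= b') at the codomain of s(a, b) meets the
    specification, since k s(a, b) is in the closed cleavage, starts at z(a) and
    lies over p z (a <= b'), hence equals s(a, b'). *)
Lemma ext_horizontal f : tri_horizontal f -> Sigma (ext_arr f).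
Proof.
move=> hf; have e := tri_horizontal_fst hf.
have [F1 F2 F3] := ext_arrP f.
have [S1 S2 S3] := ext_unitP (dom f); have [T1 T2 T3] := ext_unitP (cod f).
have hd : dom (farr p (ext_arr f)) = fobj p (cod (ext_unit (dom f))).
  by rewrite farr_dom F1.
have [k [[k1 k2 k3] _]] := cl_lift Sigma hd.
suff -> : ext_arr f = k by [].
apply: ext_arr_uniq; split; rewrite ?k3 //.
have hd2 : dom (farr p (ext_unit (cod f))) = fobj p (dom (ext_unit (cod f))).
  exact: farr_dom.
have [l [_ lu]] := cl_lift Sigma hd2.
rewrite hf farr_idt tcmp_idr; last by rewrite T2 e.
rewrite -(lu _ (And3 T1 erefl erefl)).
symmetry; apply: lu; split.
- by rewrite -(tcmpE (esym k2)); apply: Sigma_closed.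
- by rewrite dom_tcmp // S2 T2 e.
- rewrite farr_tcmp // k3 -farr_tcmp // F3 hf farr_idt tcmp_idr //.
  by rewrite T2 e.
Qed.

(** The cartesian arrows of T_n are the horizontal ones. *)
Lemma ext_cart f : cartesian (proj (tri n)) f -> cartesian p (farr ext_functor f).
Proof. by move=> /(proj1 (tri_coord n)) hf; apply: cl_cart; exact: ext_horizontal. Qed.

Definition ext : fibmap (tri n) xi := @FibMap (tri n) xi ext_functor (fcomp p z) ext_square ext_cart.

(** Normality: the identity of z(a) is the lift of an identity. *)
Lemma ext_unit_diag (a : 'I_n.+1) : ext_unit (fobj (tri_diag n) a) = idt (fobj z a).
Proof.
have [S1 S2 S3] := ext_unitP (fobj (tri_diag n) a).
have hd : dom (farr p (idt (fobj z a))) = fobj p (fobj z a).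
  by rewrite farr_dom dom_idt.
have [l [_ lu]] := cl_lift Sigma hd.
rewrite -(lu (idt _)); last by split; rewrite ?dom_idt //; apply: cl_idt.
symmetry; apply: lu; split=> //; rewrite S3 -farr_idt; congr (farr p (farr z _)).
exact: ordarr_eq.
Qed.

Lemma ext_diag : fcomp (ftot ext) (tri_diag n) = z.
Proof.
apply: functor_eq => f; apply: ext_arr_uniq.
have ef : farr (tri_proj n) (farr (tri_diag n) f) = f by exact: ordarr_eq.
have ef' : farr (tri_fst n) (farr (tri_diag n) f) = f by exact: ordarr_eq.
split.
- by rewrite farr_dom [in RHS]farr_dom ext_unit_diag cod_idt.
- by rewrite ef.
- by rewrite ef' (farr_dom (tri_diag n)) (farr_cod (tri_diag n)) !ext_unit_diag
    tcmp_idl ?tcmp_idr ?farr_dom ?farr_cod.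
Qed.

End Extend.

Theorem mainTheorem5 (xi : fibration) (Sigma : cleavage xi)
    (Sigma_closed : closed_cleavage Sigma) :
  is_sset_iso (X := codiag (cnerve Sigma)) (Y := nerve (total xi))
    (fun n x => kbar (codiag_map (cnerve_incl Sigma) x)).
Proof.
have [cd cs] := codiag_map_sset_map (cnerve_incl Sigma).
have [kd ks] := kbar_sset_map xi.
apply: bijective_sset_iso.
- by split=> n i x; [rewrite cd kd | rewrite cs ks].
- move=> n y y' /= h; apply: codiag_incl_inj.
  rewrite -(glueK (codiag_map _ y)) -(glueK (codiag_map _ y')); congr tri_codiag.
  by apply: (tri_cleaved_inj (Sigma := Sigma)) => //; exact: glue_cleaved.
- move=> n z; have [y hy] := tri_cleaved_codiag
    (@ext_horizontal _ _ Sigma_closed _ z : tri_cleaved Sigma (ext Sigma_closed z)).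
  by exists y; rewrite hy kbar_tri_codiag ext_diag.
Qed.
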